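(* Let $d,K,J\ge1$ be integers and $\kappa_y>0$. For every $R\ge1$ there exists a constant $L_{\mathsf B}=L_{\mathsf B}(R,\kappa_y)$ such that, whenever $y_1^\dagger,\dots,y_J^\dagger\in\mathbb R^K$ satisfy $\max_{1\le j\le J}|y_j^\dagger|\le\kappa_y$, one has for all Gaussian probability measures $\pi,p\in\mathcal G_R(\mathbb R^d\times\mathbb R^K)$ and all $j\in\{0,\dots,J-1\}$ $$d_g(\mathsf B_j\pi,\mathsf B_jp)\le L_{\mathsf B}(R,\kappa_y)\,d_g(\pi,p).$$
   Context: $\mathcal M(\mu)$ and $\mathcal C(\mu)$ are the mean and covariance of $\mu$. $\mathcal G_R(\mathbb R^n)$ is the set of Gaussian probability measures on $\mathbb R^n$ with $|\mathcal M(\mu)|\le R$ and $R^{-2}I_n\preccurlyeq\mathcal C(\mu)\preccurlyeq R^2I_n$ (Loewner order); here $n=d+K$. With $g(v)=1+|v|^2$ on $\mathbb R^n$ (Euclidean norm), $d_g(\mu_1,\mu_2)=\sup_{|f|\le g}\left|\int f\,d\mu_1-\int f\,d\mu_2\right|$ for probability measures with finite second moments, the supremum being over measurable $f$ with $|f|\le g$ pointwise. For $\pi$ on $\mathbb R^d\times\mathbb R^K$ with continuous Lebesgue density (denoted by the same symbol), $\mathsf B_j\pi$ is the probability measure on $\mathbb R^d$ with density $\mathsf B_j\pi(u)=\pi(u,y_{j+1}^\dagger)\big/\int_{\mathbb R^d}\pi(U,y_{j+1}^\dagger)\,dU$. The dimensions $d,K$ are fixed, so the constant may depend on them. *)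

(* Defs.v *)
From HB Require Import structures.
From mathcomp Require Import all_boot all_order all_algebra.
From mathcomp Require Import all_classical all_reals all_analysis.

Set Implicit Arguments.
Unset Strict Implicit.
Unset Printing Implicit Defensive.

Import Order.TTheory GRing.Theory Num.Theory.
Import numFieldNormedType.Exports.

Local Open Scope classical_set_scope.
Local Open Scope ring_scope.

(* Points of R^n are row vectors 'rV[R]_n, which carry the library's topology
   and linear algebra; a point (u, v) of R^d x R^K is row_mx u v : 'rV_(d + K).
   The sigma-algebra on R^n is the product of the Borel sigma-algebras of the
   coordinates (the Borel sigma-algebra of R^n), set up as the library does for
   n-tuples. *)
Definition measure_rV_display : measure_display -> measure_display.
Proof. exact. Qed.

Section measurable_rV.
Context {d} {T : measurableType d}.
Variable n : nat.

Let coors : 'I_n -> 'rV[T]_n -> T := fun i x => x ord0 i.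

Let rV_set0 : g_sigma_preimage coors set0.
Proof. exact: sigma_algebra0. Qed.

Let rV_setC A : g_sigma_preimage coors A -> g_sigma_preimage coors (~` A).
Proof. exact: sigma_algebraC. Qed.

Let rV_bigcup (F : _^nat) : (forall i, g_sigma_preimage coors (F i)) ->
  g_sigma_preimage coors (\bigcup_i (F i)).
Proof. exact: sigma_algebra_bigcup. Qed.

HB.instance Definition _ := @isMeasurable.Build (measure_rV_display d)
  'rV[T]_n (g_sigma_preimage coors) rV_set0 rV_setC rV_bigcup.

End measurable_rV.

Lemma measurable_coord d (T : measurableType d) n (i : 'I_n) :
  measurable_fun [set: 'rV[T]_n] (fun x : 'rV[T]_n => x ord0 i).
Proof.
move=> _ Y mY; rewrite setTI; apply: sub_sigma_algebra => /=.
rewrite -bigcup_seq/=; exists i => /=; first by rewrite mem_index_enum.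
by exists Y => //; rewrite setTI.
Qed.

Lemma measurable_fun_rVP d d' (S : measurableType d) (T : measurableType d')
    n (f : S -> 'rV[T]_n) :
  (forall i, measurable_fun [set: S] (fun s => f s ord0 i)) ->
  measurable_fun [set: S] f.
Proof.
move=> mf.
suff H : g_sigma_preimage (fun i s => f s ord0 i) `<=` measurable.
  move=> _ A mA; rewrite setTI; apply: H.
  rewrite (g_sigma_preimage_comp (fun i (x : 'rV[T]_n) => x ord0 i) f).
  by exists A => //; rewrite setTI.
apply: smallest_sub; first exact: sigma_algebra_measurable.
rewrite -bigcup_seq => A [i _ [B mB <-]].
exact: mf.
Qed.

Section lebesgue_rV.
Context {R : realType}.
Local Open Scope ereal_scope.

Definition cons_rV n (z : measurableTypeR R * 'rV[R]_n) : 'rV[R]_n.+1 :=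
  row_mx (z.1)%:M z.2.

Lemma cons_rV0 n (z : measurableTypeR R * 'rV[R]_n) :
  cons_rV z ord0 ord0 = z.1.
Proof.
have <- : lshift n (ord0 : 'I_1) = ord0 :> 'I_n.+1 by exact: val_inj.
exact: etrans (row_mxEl _ _ _ _) (mxE _ _ _ _).
Qed.

Lemma cons_rVS n (z : measurableTypeR R * 'rV[R]_n) (i : 'I_n) :
  cons_rV z ord0 (lift ord0 i) = z.2 ord0 i.
Proof.
have <- : rshift 1 i = lift ord0 i :> 'I_n.+1 by exact: val_inj.
exact: row_mxEr.
Qed.

Lemma measurable_cons_rV n : measurable_fun setT (@cons_rV n).
Proof.
apply: measurable_fun_rVP => i.
case: (unliftP ord0 i) => [j ->|->]; last first.
  by under eq_fun do rewrite cons_rV0; exact: measurable_fst.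
under eq_fun do rewrite cons_rVS.
exact: (measurableT_comp (measurable_coord (T := R) j) measurable_snd).
Qed.

Section succ.
Variables (n : nat) (mu : {sigma_finite_measure set 'rV[R]_n -> \bar R}).

Definition lebesgue_succ : set 'rV[R]_n.+1 -> \bar R :=
  pushforward (lebesgue_measure \x mu) (@cons_rV n).

Let lebesgue_succ0 : lebesgue_succ set0 = 0.
Proof. by rewrite /lebesgue_succ /pushforward preimage_set0 measure0. Qed.

Let lebesgue_succ_ge0 A : 0 <= lebesgue_succ A.
Proof. by rewrite /lebesgue_succ /pushforward measure_ge0. Qed.

Let lebesgue_succ_sigma_additive : semi_sigma_additive lebesgue_succ.
Proof.
move=> F mF tF mUF; rewrite /lebesgue_succ /pushforward preimage_bigcup.
apply: measure_semi_sigma_additive.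
- by move=> k; rewrite -[X in measurable X]setTI; exact: measurable_cons_rV.
- apply/trivIsetP => /= i j _ _ ij; rewrite -preimage_setI.
  by move/trivIsetP : tF => /(_ i j) ->//; rewrite preimage_set0.
- rewrite -preimage_bigcup -[X in measurable X]setTI.
  exact: measurable_cons_rV.
Qed.

HB.instance Definition _ := isMeasure.Build _ _ _ lebesgue_succ
  lebesgue_succ0 lebesgue_succ_ge0 lebesgue_succ_sigma_additive.

Let uncons_rV (x : 'rV[R]_n.+1) : measurableTypeR R * 'rV[R]_n :=
  (x ord0 ord0, \row_i x ord0 (lift ord0 i)).

Let cons_rVK z : uncons_rV (cons_rV z) = z.
Proof.
rewrite /uncons_rV cons_rV0 [RHS]surjective_pairing; congr pair.
by apply/rowP => i; rewrite mxE cons_rVS.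
Qed.

Let lebesgue_succ_sigma_finite : sigma_finite setT lebesgue_succ.
Proof.
have /sigma_finiteP[F [UF ndF mF]] :=
  sigma_finiteT (@lebesgue_measure R).
have /sigma_finiteP[G [UG ndG mG]] := sigma_finiteT mu.
exists (fun k => uncons_rV @^-1` (F k `*` G k)).
  rewrite -preimage_bigcup (_ : \bigcup_k _ = setT) ?preimage_setT//.
  rewrite -setXTT UF UG predeqE => -[x y]; split.
    by move=> [i _ []/= ? ?]; split; exists i.
  move=> [/= [i _ Fix] [j _ Gjy]]; exists (maxn i j) => //; split.
  - by move: x Fix; exact/subsetPset/ndF/leq_maxl.
  - by move: y Gjy; exact/subsetPset/ndG/leq_maxr.
move=> k; have [mFk Fk_oo] := mF k; have [mGk Gk_oo] := mG k; split.
  rewrite -[X in measurable X]setTI.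
  suff mu_ : measurable_fun setT uncons_rV.
    by apply: mu_ => //; exact: measurableX.
  apply/measurable_fun_pair; first exact: (measurable_coord (T := R)).
  apply: measurable_fun_rVP => i /=; under eq_fun do rewrite mxE.
  exact: (measurable_coord (T := R)).
rewrite /lebesgue_succ /pushforward -comp_preimage.
rewrite (_ : uncons_rV \o _ = id); last first.
  by apply/funext => z /=; exact: cons_rVK.
by rewrite product_measure1E// lte_mul_pinfty// ge0_fin_numE.
Qed.

HB.instance Definition _ := Measure_isSigmaFinite.Build _ _ _ lebesgue_succ
  lebesgue_succ_sigma_finite.

End succ.

Fixpoint lebesgue_rV n : {sigma_finite_measure set 'rV[R]_n -> \bar R} :=
  if n is m.+1 then lebesgue_succ (lebesgue_rV m)
  else \d_(0%R : 'rV[R]_0).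

End lebesgue_rV.
Arguments lebesgue_rV {R} n.

Section gaussian.
Context {R : realType}.

Definition enorm n (v : 'rV[R]_n) : R := Num.sqrt (\sum_i v ord0 i ^+ 2).

Definition psd n (A : 'M[R]_n) : Prop :=
  A^T = A /\ forall v : 'rV[R]_n, 0 <= (v *m A *m v^T) ord0 ord0.

Definition pd n (A : 'M[R]_n) : Prop :=
  A^T = A /\ forall v : 'rV[R]_n, v != 0 -> 0 < (v *m A *m v^T) ord0 ord0.

Definition loewner n (A B : 'M[R]_n) : Prop := psd (B - A).

Definition mean n (mu : probability 'rV[R]_n R) : 'rV[R]_n :=
  \row_i fine 'E_mu[fun x => x ord0 i].

Definition cov n (mu : probability 'rV[R]_n R) : 'M[R]_n :=
  \matrix_(i, j) fine (covariance mu (fun x => x ord0 i) (fun x => x ord0 j)).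

Definition density n (mu : set 'rV[R]_n -> \bar R) (f : 'rV[R]_n -> R) : Prop :=
  [/\ measurable_fun setT f, forall x, 0 <= f x &
      forall A, measurable A ->
        mu A = (\int[lebesgue_rV n]_(x in A) (f x)%:E)%E].

Definition gaussian_pdf n (m : 'rV[R]_n) (C : 'M[R]_n) (x : 'rV[R]_n) : R :=
  expR (- ((x - m) *m invmx C *m (x - m)^T) ord0 ord0 / 2) /
  Num.sqrt ((2 * pi) ^+ n * \det C).

(* Only the nondegenerate Gaussians N(m, C): a degenerate Gaussian has a
   singular covariance, hence satisfies no bound r^-2 I <= cov. *)
Definition gaussian n (mu : probability 'rV[R]_n R) : Prop :=
  exists m C, pd C /\ density mu (gaussian_pdf m C).

Definition gaussian_within n (r : R) (mu : probability 'rV[R]_n R) : Prop :=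
  [/\ gaussian mu, enorm (mean mu) <= r,
      loewner (r ^- 2)%:M (cov mu) & loewner (cov mu) (r ^+ 2)%:M].

End gaussian.

Section weighted_distance.
Context {R : realType}.
Local Open Scope ereal_scope.

(* Defined for all set functions, as the integral is, but meant for probability
   measures with finite second moments, where both integrals are finite. *)
Definition dist_g n (mu1 mu2 : set 'rV[R]_n -> \bar R) : \bar R :=
  ereal_sup [set `|\int[mu1]_x (f x)%:E - \int[mu2]_x (f x)%:E| |
    f in [set f : 'rV[R]_n -> R | measurable_fun setT f /\
                forall x, (`|f x| <= 1 + enorm x ^+ 2)%R]].

End weighted_distance.

Section conditioning.
Context {R : realType}.

(* The continuous density of mu; it is unique when it exists, as nonempty open
   sets have positive Lebesgue measure. *)
Definition cdensity n (mu : set 'rV[R]_n -> \bar R) : 'rV[R]_n -> R :=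
  xget (fun=> 0) [set f | continuous f /\ density mu f].

(* The law of u given that the second component of (u, v) ~ mu equals y. *)
Definition condition d K (y : 'rV[R]_K) (mu : set 'rV[R]_(d + K) -> \bar R) :
    set 'rV[R]_d -> \bar R :=
  fun A => (\int[lebesgue_rV d]_(u in A)
    (cdensity mu (row_mx u y) /
     \int[lebesgue_rV d]_U cdensity mu (row_mx U y))%:E)%E.

End conditioning.

(* Main.v *)
Require Import Defs.
From HB Require Import structures.
From mathcomp Require Import all_boot all_order all_algebra.
From mathcomp Require Import all_classical all_reals all_analysis.
From mathcomp Require Import measurable_realfun.
From mathcomp Require Import ring lra.

(** Conditioning a Gaussian on one block of its coordinates is Lipschitz for the
    weighted total variation distance because, for Gaussians, this distance
    dominates the distance between the parameters, while the conditional
    densities depend on the parameters in a Lipschitz way.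

    From the distance to the parameters: the functions [x_i] and [x_i x_j] are
    dominated by [1 + |x|^2], so [dist_g] bounds the differences of the first
    and second moments ([gaussian_params_le_dist_g]). This uses that the parameters
    [m], [C] of the density are its mean and covariance. Instead of a linear
    change of variables, the proof integrates by parts: the derivative along
    [e_i] of an affine function times the density has integral zero, because its
    integral along every line parallel to [e_i] is zero ([gauss_slice_eq0],
    [integral_eq0_along_lines], [gauss_ibp]). This is Stein's identity
    ([gaussian_stein]), and multiplying it by [C] gives the moments
    ([mean_gaussian], [cov_gaussian]).

    From the parameters to the conditional laws: the conditional density at [u]
    is [E u = exp (- q (u, y) / 2)], with [q x = (x - m) C^-1 (x - m)^T], divided
    by the integral of [E] ([integral_condition]); the normalising constant of
    the joint density cancels, and no formula for the conditional mean and
    covariance is used. The bounds on [C] give bounds on [C^-1] ([invmx_lower],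
    [invmx_upper]), hence a Gaussian upper bound for [E] ([slice_le_uniform])
    and a lower bound for its integral ([slice_mass_ge]). The resolvent identity
    shows that two exponents differ by at most a constant times the distance of
    the parameters times [1 + |x|^2] ([qf_invmx_lipschitz]), hence a pointwise
    bound on the difference of the functions [E] ([slice_lipschitz]). Integrating,
    and comparing quotients, gives the theorem ([ratio_lipschitz]).

    The conditional law is defined by the continuous density of the measure;
    that this is the Gaussian density is [cdensity_gaussian]. *)

Set Implicit Arguments.
Unset Strict Implicit.
Unset Printing Implicit Defensive.
Import Order.TTheory GRing.Theory Num.Theory.
Import numFieldNormedType.Exports.
Local Open Scope classical_set_scope.
Local Open Scope ring_scope.

(** * Quadratic forms and the Loewner order *)

Section forms.
Context {R : realType}.
Implicit Type n : nat.

Definition bil n (A : 'M[R]_n) (u v : 'rV[R]_n) : R := (u *m A *m v^T) 0 0.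
Definition qf n (A : 'M[R]_n) (v : 'rV[R]_n) : R := bil A v v.
Definition sqn n (v : 'rV[R]_n) : R := \sum_i v 0 i ^+ 2.

Lemma bilDl n (A : 'M[R]_n) u v w : bil A (u + v) w = bil A u w + bil A v w.
Proof. by rewrite /bil !mulmxDl mxE. Qed.
Lemma bilDr n (A : 'M[R]_n) u v w : bil A u (v + w) = bil A u v + bil A u w.
Proof. by rewrite /bil linearD mulmxDr mxE. Qed.
Lemma bilZl n (A : 'M[R]_n) a u v : bil A (a *: u) v = a * bil A u v.
Proof. by rewrite /bil -!scalemxAl mxE. Qed.
Lemma bilZr n (A : 'M[R]_n) a u v : bil A u (a *: v) = a * bil A u v.
Proof. by rewrite /bil linearZ/= -!scalemxAr mxE. Qed.
Lemma bilNl n (A : 'M[R]_n) u v : bil A (- u) v = - bil A u v.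
Proof. by rewrite -scaleN1r bilZl mulN1r. Qed.
Lemma bilNr n (A : 'M[R]_n) u v : bil A u (- v) = - bil A u v.
Proof. by rewrite -scaleN1r bilZr mulN1r. Qed.

Lemma bilC n (A : 'M[R]_n) u v : A^T = A -> bil A u v = bil A v u.
Proof.
move=> sA; have -> : bil A v u = (v *m A *m u^T)^T 0 0 by rewrite mxE.
by rewrite !trmx_mul trmxK sA mulmxA.
Qed.

Lemma bil_delta n (A : 'M[R]_n) u i : bil A u (delta_mx 0 i) = (u *m A) 0 i.
Proof.
rewrite /bil mxE (bigD1 i)//= big1 ?addr0 => [|j ji]; rewrite !mxE !eqxx.
  by rewrite mulr1.
by rewrite (negbTE ji) mulr0.
Qed.

Lemma qf_delta n (A : 'M[R]_n) i : qf A (delta_mx 0 i) = A i i.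
Proof. by rewrite /qf bil_delta -rowE mxE. Qed.

Lemma sqnE n (v : 'rV[R]_n) : sqn v = (v *m v^T) 0 0.
Proof. by rewrite mxE; apply: eq_bigr => i _; rewrite mxE expr2. Qed.

Lemma sqn_bil n (v : 'rV[R]_n) : sqn v = bil 1%:M v v.
Proof. by rewrite sqnE /bil mulmx1. Qed.

Lemma sqn_ge0 n (v : 'rV[R]_n) : 0 <= sqn v.
Proof. by apply: sumr_ge0 => i _; rewrite sqr_ge0. Qed.

Lemma coord_le_sqn n (v : 'rV[R]_n) i : v 0 i ^+ 2 <= sqn v.
Proof. by rewrite /sqn (bigD1 i)//= lerDl sumr_ge0// => j _; rewrite sqr_ge0. Qed.

Lemma sqn_gt0 n (v : 'rV[R]_n) : v != 0 -> 0 < sqn v.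
Proof.
move=> v0; rewrite lt_def sqn_ge0 andbT; apply: contra v0 => /eqP v0.
apply/eqP/rowP => i; rewrite mxE; apply/eqP; rewrite -sqrf_eq0 eq_le sqr_ge0 andbT.
by rewrite -v0 coord_le_sqn.
Qed.

Lemma sqnD n (u v : 'rV[R]_n) : sqn (u + v) <= 2 * sqn u + 2 * sqn v.
Proof.
rewrite /sqn !mulr_sumr -big_split/=; apply: ler_sum => i _; rewrite mxE.
have := sqr_ge0 (u 0 i - v 0 i); lra.
Qed.

Lemma sqnN n (u : 'rV[R]_n) : sqn (- u) = sqn u.
Proof. by apply: eq_bigr => i _; rewrite mxE sqrrN. Qed.

Lemma sqnB n (u v : 'rV[R]_n) : sqn (u - v) <= 2 * sqn u + 2 * sqn v.
Proof. by rewrite -(sqnN v) sqnD. Qed.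

Lemma sqn_row d k (u : 'rV[R]_d) (y : 'rV[R]_k) :
  sqn (row_mx u y) = sqn u + sqn y.
Proof.
by rewrite /sqn big_split_ord/=; congr (_ + _); apply: eq_bigr => i _;
  rewrite ?row_mxEl ?row_mxEr.
Qed.

Lemma enorm_sqr n (v : 'rV[R]_n) : enorm v ^+ 2 = sqn v.
Proof. by rewrite sqr_sqrtr// sqn_ge0. Qed.

Lemma enorm_le n (v : 'rV[R]_n) r : enorm v <= r -> sqn v <= r ^+ 2.
Proof.
move=> h; rewrite -enorm_sqr; have := sqrtr_ge0 (sqn v); rewrite -/(enorm v).
by move=> h0; rewrite ler_pXn2r// nnegrE// (le_trans h0).
Qed.

Lemma loewner_lowerP n (a : R) (A : 'M[R]_n) : loewner a%:M A ->
  forall v, a * sqn v <= qf A v.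
Proof.
move=> [_ H] v; move: (H v); rewrite mulmxBr mulmxBl mxE mul_mx_scalar.
by rewrite -scalemxAl [X in _ + X]mxE [X in _ - X]mxE -sqnE subr_ge0.
Qed.

Lemma loewner_upperP n (a : R) (A : 'M[R]_n) : loewner A a%:M ->
  forall v, qf A v <= a * sqn v.
Proof.
move=> [_ H] v; move: (H v); rewrite mulmxBr mulmxBl mxE mul_mx_scalar.
by rewrite -scalemxAl [X in X + _]mxE [X in _ + X]mxE -sqnE subr_ge0.
Qed.

Lemma pd_qf_gt0 n (A : 'M[R]_n) v : pd A -> v != 0 -> 0 < qf A v.
Proof. by move=> [_]; exact. Qed.

Lemma pd_qf_ge0 n (A : 'M[R]_n) v : pd A -> 0 <= qf A v.
Proof.
move=> pA; have [->|v0] := eqVneq v 0; last exact/ltW/pd_qf_gt0.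
by rewrite /qf /bil mul0mx mul0mx mxE.
Qed.

Lemma pd_unitmx n (A : 'M[R]_n) : pd A -> A \in unitmx.
Proof.
move=> pA; rewrite -row_free_unit -kermx_eq0; apply/eqP/row_matrixP => i.
rewrite row0; apply/eqP; apply: contraT => v0.
have := pd_qf_gt0 pA v0; rewrite /qf /bil -row_mul mulmx_ker row0 mul0mx mxE.
by rewrite ltxx.
Qed.

Lemma invmx_sym n (A : 'M[R]_n) : A^T = A -> (invmx A)^T = invmx A.
Proof. by move=> sA; rewrite trmx_inv sA. Qed.

(** The operator bound [|v A|^2 <= c v A v^T] without spectral theory: expand
    [0 <= qf A (v - t v A)] and take [t = 1/c]. *)
Lemma sqn_mulmx n (A : 'M[R]_n) c v : A^T = A -> 0 < c ->
  (forall w, 0 <= qf A w) -> (forall w, qf A w <= c * sqn w) ->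
  sqn (v *m A) <= c * qf A v.
Proof.
move=> sA c0 pA uA; set w := v *m A.
have vw : bil A v w = sqn w by rewrite sqnE.
have := pA (v - c^-1 *: w); have := uA w.
rewrite /qf !(bilDl, bilDr, bilNl, bilNr, bilZl, bilZr) (bilC w v sA) vw.
move=> h1 h2.
have h3 : c^-1 * (c^-1 * bil A w w) <= c^-1 * sqn w.
  by rewrite ler_pM2l ?invr_gt0// ler_pdivrMl.
have h4 : c^-1 * sqn w <= bil A v v by lra.
by rewrite -ler_pdivrMl.
Qed.

Lemma qf_mul_inv n (A : 'M[R]_n) v : A \in unitmx ->
  A^T = A -> qf (invmx A) v = qf A (v *m invmx A).
Proof.
move=> uA sA; rewrite /qf /bil trmx_mul invmx_sym// -!mulmxA; congr ((_ *m _) _ _).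
by rewrite mulKmx.
Qed.

(** Inversion reverses the Loewner order: with [v = w A], the claim is
    [sqn_mulmx] at [w]. *)
Lemma invmx_lower n (A : 'M[R]_n) c v : pd A -> 0 < c ->
  (forall w, qf A w <= c * sqn w) -> c^-1 * sqn v <= qf (invmx A) v.
Proof.
move=> pA c0 uA; have uu := pd_unitmx pA; case: (pA) => sA _.
rewrite qf_mul_inv// ler_pdivrMl// -{1}(mulmxKV uu v).
by apply: sqn_mulmx => // w; exact: pd_qf_ge0.
Qed.

(** The other half, from [|v - a w|^2 >= 0] with [w = v A^-1]. *)
Lemma invmx_upper n (A : 'M[R]_n) a v : pd A -> 0 < a ->
  (forall w, a * sqn w <= qf A w) -> qf (invmx A) v <= a^-1 * sqn v.
Proof.
move=> pA a0 lA; have uu := pd_unitmx pA; case: (pA) => sA _.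
set w := v *m invmx A.
have e : qf (invmx A) v = bil 1%:M w v by rewrite /qf /bil mulmx1.
have e2 : qf (invmx A) v = qf A w by rewrite qf_mul_inv.
have h1 := lA w; rewrite -e2 e in h1; rewrite e.
have : 0 <= sqn (v - a *: w) by exact: sqn_ge0.
rewrite sqn_bil !(bilDl, bilDr, bilNl, bilNr, bilZl, bilZr).
rewrite (bilC v w (trmx1 _ _)) -!sqn_bil => h2.
rewrite ler_pdivlMl//.
have : a * (a * sqn w) <= a * bil 1%:M w v by rewrite ler_pM2l.
lra.
Qed.

(** A crude Schur test: [|u_i v_j| <= u_i^2 + v_j^2]. *)
Lemma bil_le n (A : 'M[R]_n) D u v : (forall i j, `|A i j| <= D) ->
  `|bil A u v| <= D * (n%:R * (sqn u + sqn v)).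
Proof.
move=> AD.
have -> : bil A u v = \sum_j \sum_i u 0 i * A i j * v 0 j.
  by rewrite /bil mxE; apply: eq_bigr => j _; rewrite !mxE mulr_suml.
have -> : D * (n%:R * (sqn u + sqn v)) =
    \sum_(j < n) \sum_(i < n) D * (u 0 i ^+ 2 + v 0 j ^+ 2).
  under eq_bigr => j _ do rewrite -mulr_sumr big_split/= sumr_const card_ord.
  rewrite -mulr_sumr; congr (_ * _).
  rewrite big_split/= sumr_const card_ord mulrDr !mulr_natl; congr (_ + _).
  by rewrite sumrMnl.
apply: (le_trans (ler_norm_sum _ _ _)); apply: ler_sum => j _.
apply: (le_trans (ler_norm_sum _ _ _)); apply: ler_sum => i _.
rewrite !normrM mulrAC mulrC ler_pM ?mulr_ge0//.
rewrite -(real_normK (num_real (u 0 i))) -(real_normK (num_real (v 0 j))).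
have := normr_ge0 (u 0 i); have := normr_ge0 (v 0 j); nra.
Qed.

Lemma qf_bounded n (A : 'M[R]_n) :
  exists2 c, 0 < c & forall v, qf A v <= c * sqn v.
Proof.
pose M := \sum_i \sum_j `|A i j|.
have M0 : 0 <= M by do 2 (apply: sumr_ge0 => ? _).
have AM i j : `|A i j| <= M.
  rewrite /M (bigD1 i)//= (bigD1 j)//= -addrA lerDl addr_ge0// ?sumr_ge0// => *.
  exact: sumr_ge0.
exists (1 + M * n%:R * 2).
  by rewrite ltr_pwDl// !mulr_ge0.
move=> v; have := bil_le v v AM; move/(le_trans (ler_norm _)) => h.
apply: (le_trans h); have := sqn_ge0 v; set s := sqn v => s0.
have : 0 <= n%:R :> R by []. set k := n%:R => k0; nra.
Qed.

(** Provides the Gaussian decay of a density of which only the positivity of the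
    matrix is known, before its moments are identified. *)
Lemma pd_inv_lower n (A : 'M[R]_n) : pd A ->
  exists2 a, 0 < a & forall v, a * sqn v <= qf (invmx A) v.
Proof.
move=> pA; have [c c0 h] := qf_bounded A.
by exists c^-1 => [|v]; rewrite ?invr_gt0//; exact: invmx_lower.
Qed.

(** The Lipschitz constant, in the parameters, of the exponent of a Gaussian: the
    first summand is the share of the means, the second that of the
    covariances. *)
Definition qf_lip n (r : R) : R :=
  (n%:R + r ^+ 4 * (8 * r ^+ 2)) + (1 + 2 * r) * n%:R * (r ^+ 4 * (4 * r ^+ 2)).

Lemma qf_lip_ge0 n (r : R) : 0 <= r -> 0 <= qf_lip n r.
Proof. by move=> r0; rewrite /qf_lip !(mulr_ge0, addr_ge0, exprn_ge0). Qed.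

(** Only the covariances are known to be close, but the resolvent identity
    [P - P' = P (C' - C) P'] for the inverses [P], [P'] of [C], [C'] turns this
    into closeness of the inverses: [z (P - P') z^T] is the form of [C' - C] at
    the vectors [z P] and [z P'], whose lengths are controlled by [sqn_mulmx].
    The change of centre is handled by polarisation. *)
Lemma qf_invmx_lipschitz n (r D : R) (C C' : 'M[R]_n) (m m' x : 'rV[R]_n) :
  1 <= r -> 0 <= D -> pd C -> pd C' ->
  (forall v, (r ^+ 2)^-1 * sqn v <= qf C v) ->
  (forall v, (r ^+ 2)^-1 * sqn v <= qf C' v) ->
  sqn m <= r ^+ 2 -> sqn m' <= r ^+ 2 ->
  (forall i, `|m 0 i - m' 0 i| <= D) ->
  (forall i j, `|C i j - C' i j| <= (1 + 2 * r) * D) ->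
  `|qf (invmx C) (x - m) - qf (invmx C') (x - m')| <=
    D * (qf_lip n r * (1 + sqn x)).
Proof.
move=> r1 D0 pC pC' lC lC' mr mr' mD CD.
have r0 : 0 < r by rewrite (lt_le_trans ltr01).
have r20 : 0 < r ^+ 2 by rewrite exprn_gt0.
have r2i : 0 < (r ^+ 2)^-1 by rewrite invr_gt0.
have uP v : qf (invmx C) v <= r ^+ 2 * sqn v.
  by have := invmx_upper v pC r2i lC; rewrite invrK.
have uP' v : qf (invmx C') v <= r ^+ 2 * sqn v.
  by have := invmx_upper v pC' r2i lC'; rewrite invrK.
have [uC uC'] := (pd_unitmx pC, pd_unitmx pC').
have [sC _] := pC; have [sC' _] := pC'.
have sP := invmx_sym sC; have sP' := invmx_sym sC'.
have P0 v : 0 <= qf (invmx C) v by rewrite qf_mul_inv// pd_qf_ge0.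
have P0' v : 0 <= qf (invmx C') v by rewrite qf_mul_inv// pd_qf_ge0.
have r4 : r ^+ 4 = r ^+ 2 * r ^+ 2 by rewrite -exprD.
have nP v : sqn (v *m invmx C) <= r ^+ 4 * sqn v.
  by rewrite r4 -mulrA (le_trans (sqn_mulmx _ sP r20 P0 uP))// ler_pM2l.
have nP' v : sqn (v *m invmx C') <= r ^+ 4 * sqn v.
  by rewrite r4 -mulrA (le_trans (sqn_mulmx _ sP' r20 P0' uP'))// ler_pM2l.
have e1 z z' : qf (invmx C) z - qf (invmx C) z' = bil (invmx C) (z + z') (z - z').
  rewrite /qf !(bilDl, bilDr, bilNl, bilNr) (bilC z' z sP); ring.
have e2 z' : qf (invmx C) z' - qf (invmx C') z' =
    bil (C' - C) (z' *m invmx C) (z' *m invmx C').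
  rewrite /qf /bil trmx_mul sP' !mulmxA mulmxBr.
  rewrite mulmxKV// !mulmxBl mulmxK//.
  by rewrite [RHS]mxE; congr (_ + _); rewrite [RHS]mxE.
set z := x - m; set z' := x - m'.
have r21 : 1 <= r ^+ 2 by rewrite exprn_ege1.
have x0 := sqn_ge0 x.
have hz : sqn z <= 2 * r ^+ 2 * (1 + sqn x).
  by apply: (le_trans (sqnB _ _)); nra.
have hz' : sqn z' <= 2 * r ^+ 2 * (1 + sqn x).
  by apply: (le_trans (sqnB _ _)); nra.
have hzz : sqn (z + z') <= 8 * r ^+ 2 * (1 + sqn x).
  by apply: (le_trans (sqnD _ _)); lra.
rewrite /qf_lip [_ * (1 + sqn x)]mulrDl -(subrKA (qf (invmx C) z')) e1 e2.
apply: (le_trans (ler_normD _ _)); rewrite mulrDr lerD//.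
  have -> : bil (invmx C) (z + z') (z - z') =
      \sum_i ((z + z') *m invmx C) 0 i * (m' 0 i - m 0 i).
    rewrite /bil mxE; apply: eq_bigr => i _; congr (_ * _).
    by rewrite !mxE; ring.
  apply: (@le_trans _ _ (D * (n%:R + sqn ((z + z') *m invmx C)))).
    have -> : D * (n%:R + sqn ((z + z') *m invmx C)) =
        \sum_i D * (1 + (((z + z') *m invmx C) 0 i) ^+ 2).
      by rewrite -mulr_sumr big_split/= sumr_const card_ord.
    apply: (le_trans (ler_norm_sum _ _ _)); apply: ler_sum => i _.
    rewrite normrM mulrC distrC ler_pM//.
    set t := (_ *m _) _ _; rewrite -(real_normK (num_real t)).
    by have := normr_ge0 t; nra.
  rewrite ler_wpM2l// mulrDl lerD//; first by rewrite ler_peMr// lerDl.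
  apply: (le_trans (nP _)); rewrite -mulrA ler_wpM2l//.
  by rewrite exprn_ge0// ltW.
have {}CD i j : `|(C' - C) i j| <= (1 + 2 * r) * D.
  by rewrite !mxE distrC CD.
apply: (le_trans (bil_le _ _ CD)).
have hs : sqn (z' *m invmx C) + sqn (z' *m invmx C') <= r ^+ 4 * (4 * r ^+ 2 * (1 + sqn x)).
  apply: (le_trans (lerD (nP _) (nP' _))).
  rewrite -mulrDr ler_wpM2l ?exprn_ge0 ?(ltW r0)//; lra.
have -> : D * ((1 + 2 * r) * n%:R * (r ^+ 4 * (4 * r ^+ 2)) * (1 + sqn x))
   = ((1 + 2 * r) * D) * (n%:R * (r ^+ 4 * (4 * r ^+ 2 * (1 + sqn x)))) by ring.
by rewrite ler_wpM2l ?mulr_ge0 ?ler_wpM2l//; lra.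
Qed.

End forms.

(** * Integration on row vectors *)

Section lebesgue_integration.
Context {R : realType}.
Implicit Type n : nat.

(** A form of [measurable_EFinP] specialised to row vectors, for which the two
    structures on the source are recognised as equal. *)
Lemma measurable_EFin_rV n (f : 'rV[R]_n -> R) :
  measurable_fun setT f -> measurable_fun setT (fun x => (f x)%:E).
Proof. by move/measurable_EFinP. Qed.

Lemma measurable_sqn n : measurable_fun setT (@sqn R n).
Proof.
by apply: measurable_sum => i; apply: measurable_funX; exact: (measurable_coord (T := R)).
Qed.

Lemma measurable_mulmx n k (A : 'M[R]_(n, k)) j :
  measurable_fun setT (fun v : 'rV[R]_n => (v *m A) 0 j).
Proof.
under eq_fun do rewrite mxE.
by apply: measurable_sum => i; apply: measurable_funM; [exact: (measurable_coord (T := R))|].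
Qed.

Lemma measurable_qf n (A : 'M[R]_n) (m : 'rV[R]_n) :
  measurable_fun setT (fun v : 'rV[R]_n => qf A (v - m)).
Proof.
rewrite /qf /bil; under eq_fun do rewrite mxE.
apply: measurable_sum => i; apply: measurable_funM.
  under eq_fun do rewrite mulmxBl mxE.
  by apply: measurable_funD => //; exact: measurable_mulmx.
under eq_fun do rewrite !mxE.
by apply: measurable_funD => //; exact: (measurable_coord (T := R)).
Qed.

Lemma measurable_row_mx d k (y : 'rV[R]_k) :
  measurable_fun setT (fun u : 'rV[R]_d => row_mx u y).
Proof.
apply: (@measurable_fun_rVP _ _ _ (measurableTypeR R)) => i; rewrite -[i]splitK.
case: (fintype.split i) => j /=.
  by under eq_fun do rewrite row_mxEl; exact: (measurable_coord (T := R)).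
by under eq_fun do rewrite row_mxEr; exact: measurable_cst.
Qed.

Lemma integral_gauss_line (a : R) : 0 < a -> exists2 c : R, 0 < c &
  (\int[lebesgue_measure]_(t in setT) (expR (- a * t ^+ 2))%:E = c%:E)%E.
Proof.
move=> a0; pose s : R := Num.sqrt ((2 * a)^-1).
have s0 : s != 0 by rewrite gt_eqF// sqrtr_gt0 invr_gt0; lra.
have s2 : s ^+ 2 = (2 * a)^-1 by rewrite sqr_sqrtr// invr_ge0; lra.
have p0 := normal_peak_gt0 s0.
exists (normal_peak s)^-1; first by rewrite invr_gt0.
have e t : expR (- a * t ^+ 2) = (normal_peak s)^-1 * normal_pdf 0 s t.
  rewrite normal_pdfE// mulKf ?gt_eqF// /normal_fun subr0 s2; congr expR.
  by field; rewrite gt_eqF.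
under eq_integral do rewrite e EFinM.
by rewrite integralZl//= ?integral_normal_pdf ?mule1//; exact: integrable_normal_pdf.
Qed.

Lemma integral_lebesgue_rV0 (f : 'rV[R]_0 -> R) : measurable_fun setT f ->
  (\int[lebesgue_rV 0]_x (f x)%:E = (f 0)%:E)%E.
Proof.
move=> mf; rewrite integral_dirac//= ?diracT ?mul1e//; exact: measurable_EFin_rV.
Qed.

Lemma sqn_cons n (z : measurableTypeR R * 'rV[R]_n) :
  sqn (cons_rV z) = z.1 ^+ 2 + sqn z.2.
Proof.
rewrite /sqn big_ord_recl cons_rV0; congr (_ + _).
by apply: eq_bigr => i _; rewrite cons_rVS.
Qed.

Lemma ge0_integral_lebesgue_rVS n (f : 'rV[R]_n.+1 -> \bar R) :
  measurable_fun setT f -> (forall x, 0 <= f x)%E ->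
  (\int[lebesgue_rV n.+1]_x f x =
   \int[lebesgue_measure]_t \int[lebesgue_rV n]_y f (@cons_rV R n (t, y)))%E.
Proof.
move=> mf f0; rewrite ge0_integral_pushforward//; last exact: measurable_cons_rV.
rewrite preimage_setT fubini_tonelli1//=.
by apply: measurableT_comp mf _; exact: measurable_cons_rV.
Qed.

Lemma integral_gauss_rV n (a c : R) : 0 < c ->
  (\int[lebesgue_measure]_t (expR (- a * t ^+ 2))%:E = c%:E)%E ->
  (\int[lebesgue_rV n]_x (expR (- a * sqn x))%:E = (c ^+ n)%:E)%E.
Proof.
move=> c0 hc; elim: n => [|n IH].
  rewrite integral_lebesgue_rV0 ?expr0.
    by rewrite /sqn big_ord0 mulr0 expR0.
  apply: measurableT_comp => //; apply: measurable_funM => //.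
  exact: measurable_sqn.
have m1 k : measurable_fun setT (fun x : 'rV[R]_k => expR (- a * sqn x)).
  apply: measurableT_comp => //; apply: measurable_funM => //.
  exact: measurable_sqn.
rewrite ge0_integral_lebesgue_rVS//=; last exact: (measurable_EFin_rV (m1 _)).
transitivity (\int[@lebesgue_measure R]_t
    ((expR (- a * t ^+ 2))%:E * (c ^+ n)%:E))%E.
  apply: eq_integral => t _.
  under eq_integral => y _ do rewrite sqn_cons/= mulrDr expRD EFinM.
  rewrite ge0_integralZl ?IH//=.
  exact: (measurable_EFin_rV (m1 _)).
rewrite ge0_integralZr//=; first by rewrite hc -EFinM exprS.
  apply/measurable_EFinP; apply: measurableT_comp => //; apply: measurable_funM => //.
by rewrite lee_fin exprn_ge0// ltW.
Qed.

Lemma integral_gauss_rV_gt0 n (a : R) : 0 < a -> exists2 c : R, 0 < c &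
  (\int[lebesgue_rV n]_x (expR (- a * sqn x))%:E = c%:E)%E.
Proof.
move=> /integral_gauss_line[c c0 h]; exists (c ^+ n); first by rewrite exprn_gt0.
exact: integral_gauss_rV.
Qed.

(** Polynomial factors are absorbed by halving the rate of decay:
    [1 + s <= (1 + 4/a) (1 + a s / 4) <= (1 + 4/a) exp (a s / 4)]. *)
Lemma poly_expR_le (a s : R) : 0 < a -> 0 <= s ->
  (1 + s) ^+ 2 * expR (- a * s) <= (1 + 4 / a) ^+ 2 * expR (- (a / 2) * s).
Proof.
move=> a0 s0.
have h : 1 + s <= (1 + 4 / a) * expR (a / 4 * s).
  apply: (@le_trans _ _ ((1 + 4 / a) * (1 + a / 4 * s))).
    have -> : (1 + 4 / a) * (1 + a / 4 * s) = 1 + s + (a / 4 * s + 4 / a).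
      by field; rewrite gt_eqF.
    have h1 : 0 <= a / 4 * s by rewrite mulr_ge0 ?divr_ge0 ?(ltW a0).
    have h2 : 0 <= 4 / a by rewrite divr_ge0 ?(ltW a0).
    by rewrite lerDl addr_ge0.
  by rewrite ler_wpM2l ?expR_ge1Dx// addr_ge0// divr_ge0// ltW.
have -> : expR (- (a / 2) * s) = expR (a / 4 * s) ^+ 2 * expR (- a * s).
  by rewrite expr2 -!expRD; congr expR; field.
rewrite mulrA -exprMn ler_wpM2r ?expR_ge0// ler_pXn2r// nnegrE.
  by rewrite addr_ge0.
by rewrite mulr_ge0 ?expR_ge0// addr_ge0// divr_ge0// ltW.
Qed.

Lemma integrable_gauss_rV n (a : R) : 0 < a ->
  (lebesgue_rV n).-integrable setT (fun x => (expR (- a * sqn x))%:E).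
Proof.
move=> a0; have [c c0 hc] := integral_gauss_rV_gt0 n a0; apply/integrableP; split.
  apply: measurable_EFin_rV; apply: measurableT_comp => //; apply: measurable_funM => //.
  exact: measurable_sqn.
under eq_integral => x _ do rewrite gee0_abs ?lee_fin ?expR_ge0//.
by rewrite hc ltry.
Qed.

Lemma integrable_poly_gauss n (a M : R) (F : 'rV[R]_n -> R) : 0 < a -> 0 <= M ->
  measurable_fun setT F ->
  (forall x, `|F x| <= M * ((1 + sqn x) ^+ 2 * expR (- a * sqn x))) ->
  (lebesgue_rV n).-integrable setT (EFin \o F).
Proof.
move=> a0 M0 mF hF.
have h := integrable_gauss_rV n (divr_gt0 a0 (ltr0Sn R 1)).
have {}h : (lebesgue_rV n).-integrable setT (fun x =>
   (M * (1 + 4 / a) ^+ 2)%:E * (expR (- (a / 2) * sqn x))%:E)%E.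
  exact: integrableZl h.
apply: le_integrable h => //; first exact: measurable_EFin_rV.
move=> x _ /=; rewrite lee_fin (le_trans (hF x))// ger0_norm; last first.
  by rewrite !mulr_ge0// ?expR_ge0// ?exprn_ge0// addr_ge0// divr_ge0// ltW.
by rewrite -(mulrA M ((1 + 4 / a) ^+ 2)) ler_wpM2l// poly_expR_le// sqn_ge0.
Qed.

(** Fubini in the direction of one coordinate. It replaces a divergence theorem:
    the only functions to which it is applied are directional derivatives, whose
    integrals along lines are computed by hand. Coordinate 0 is the first factor
    of [lebesgue_rV n.+1]; another coordinate lies in the second factor, where
    the induction hypothesis applies to almost every section. *)
Lemma integral_eq0_along_lines n (i : 'I_n) (F : 'rV[R]_n -> R) :
  (lebesgue_rV n).-integrable setT (EFin \o F) ->
  (forall x, \int[lebesgue_measure]_t (F (x + t *: delta_mx 0 i))%:E = 0)%E ->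
  (\int[lebesgue_rV n]_x (F x)%:E = 0)%E.
Proof.
elim: n i F => [[]//|n IH] i F iF F0.
have mF : measurable_fun setT F by apply/measurable_EFinP; exact: measurable_int iF.
have mG : measurable_fun setT (fun z => F (@cons_rV R n z)).
  by apply: measurableT_comp mF _; exact: measurable_cons_rV.
have mGE : measurable_fun setT (fun z => (F (@cons_rV R n z))%:E).
  by move/measurable_EFinP : mG.
have iG : (lebesgue_measure \x lebesgue_rV n)%E.-integrable setT
    (fun z => (F (@cons_rV R n z))%:E).
  apply/integrableP; split => //.
  have /integrableP[mFE] := iF.
  rewrite ge0_integral_lebesgue_rVS//=; last first.
    by apply: measurable_EFin_rV; exact: measurableT_comp.
  have mA : measurable_fun setT (fun z => `|(F (@cons_rV R n z))%:E|)%E.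
    exact: measurableT_comp.
  by rewrite fubini_tonelli1.
have -> : (\int[lebesgue_rV n.+1]_x (F x)%:E =
    \int[lebesgue_measure \x lebesgue_rV n]_z (F (@cons_rV R n z))%:E)%E.
  rewrite integral_pushforward//; first exact: measurable_cons_rV.
  exact: measurable_EFin_rV.
have h0 (z : measurableTypeR R * 'rV[R]_n) : @cons_rV R n z 0 ord0 = z.1.
  exact: cons_rV0.
have hS (z : measurableTypeR R * 'rV[R]_n) j :
  @cons_rV R n z 0 (lift ord0 j) = z.2 0 j by exact: cons_rVS.
have eD m (x v : 'rV[R]_m) (t : R) k : (x + t *: v) 0 k = x 0 k + t * v 0 k.
  by rewrite !mxE.
have ed m (k l : 'I_m) : ('e_l : 'rV[R]_m) 0 k = (k == l)%:R by rewrite mxE.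
case: (unliftP ord0 i) F0 => [j ->|->] F0; last first.
  rewrite -integral21_prod_meas1//; apply: integral0_eq => y _ /=.
  rewrite /fubini_G -[RHS](F0 (@cons_rV R n (0, y))).
  apply: eq_integral => t _; congr (F _)%:E; apply/rowP => k; rewrite eD ed.
  case: (unliftP ord0 k) => [l ->|->].
    by rewrite !hS/= mulr0 addr0.
  by rewrite !h0/= mulr1 add0r.
rewrite -integral12_prod_meas1//.
transitivity (\int[@lebesgue_measure R]_x cst 0 x)%E; last by rewrite integral0.
apply: ae_eq_integral => //.
  by have /measurable_int := integrable_fubini_F iG.
have := ae_integrable1 iG; apply: filterS => t /= it _.
apply: (IH j) => // y.
rewrite -[RHS](F0 (@cons_rV R n (t, y))).
apply: eq_integral => s _; congr (F _)%:E; apply/rowP => k; rewrite eD ed.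
case: (unliftP ord0 k) => [l ->|->].
  by rewrite !hS/= eD ed (inj_eq lift_inj).
by rewrite !h0/= mulr0 addr0.
Qed.

End lebesgue_integration.

(** * Derivatives on the real line have integral zero *)

Section line.
Context {R : realType}.
Notation leb := (@lebesgue_measure R).

(** The fundamental theorem of calculus on the whole line: the integrals from
    [- n.+1] to [n.+1] tend to the integral by dominated convergence. *)
Lemma integral_derive_eq0 (F f : R -> R) :
  continuous f -> (forall t, is_derive t (1 : R) F (f t)) ->
  leb.-integrable setT (EFin \o f) ->
  (F n.+1%:R @[n --> \oo] --> 0) -> (F (- n.+1%:R) @[n --> \oo] --> 0) ->
  (\int[leb]_t (f t)%:E = 0)%E.
Proof.
move=> cf dF intf F1 F2.
pose I n : set R := `[- n.+1%:R, n.+1%:R]%classic.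
have mf : measurable_fun setT (EFin \o f) by exact: measurable_int intf.
have eI n : (\int[leb]_(t in I n) (f t)%:E = (F n.+1%:R - F (- n.+1%:R))%:E)%E.
  rewrite EFinB; apply: continuous_FTC2.
  - by rewrite -subr_gt0 opprK addr_gt0.
  - exact: continuous_subspaceT.
  - have cF : continuous F.
      move=> t; apply: differentiable_continuous; apply/derivable1_diffP.
      by case: (dF t).
    split.
    + by move=> t _; case: (dF t).
    + exact/cvg_at_right_filter/cF.
    + exact/cvg_at_left_filter/cF.
  - by move=> t _; rewrite derive1E; apply: derive_val.
have h0 n : measurable_fun setT ((EFin \o f) \_ (I n)).
  have mI : measurable (I n) by exact: measurable_itv.
  by apply/(measurable_restrictT (EFin \o f) mI); exact: measurable_funS mf.
have h1 : {ae leb, forall t, setT t ->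
    ((EFin \o f) \_ (I n)) t @[n --> \oo] --> (EFin \o f) t}.
  apply: aeW => t _; apply: cvg_near_cst.
  near=> n; rewrite patchE mem_set// /I/= in_itv/=.
  rewrite -ler_norml; apply: (@le_trans _ _ n%:R); last by rewrite ler_nat.
  near: n; exact: nbhs_infty_ger.
have h2 : {ae leb, forall t n, setT t ->
    `|((EFin \o f) \_ (I n)) t| <= (abse \o (EFin \o f)) t}%E.
  apply: aeW => t n _; rewrite patchE; case: ifPn => // _.
  by rewrite abse0 abse_ge0.
have [_ _] := @dominated_convergence _ _ _ leb setT measurableT _ _ _
  h0 mf h1 (integrable_abse intf) h2.
have -> : [sequence (\int[leb]_t ((EFin \o f) \_ (I n)) t)%E]_n =
    (fun n => (F n.+1%:R - F (- n.+1%:R))%:E).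
  by apply/funext => n /=; rewrite -integral_mkcond eI.
move/cvg_unique; apply => //.
apply: cvg_EFin; first exact: nearW.
by rewrite -[X in _ --> X](subr0 (0:R)); exact: cvgB.
Unshelve. all: by end_near. Qed.

Lemma integrable_gauss1 (a : R) : 0 < a ->
  leb.-integrable setT (fun t => (expR (- a * t ^+ 2))%:E).
Proof.
move=> a0; have [c c0 hc] := integral_gauss_line a0; apply/integrableP; split.
  by apply/measurable_EFinP; apply: measurableT_comp => //; apply: measurable_funM => //.
under eq_integral => x _ do rewrite gee0_abs ?lee_fin ?expR_ge0//.
by rewrite hc ltry.
Qed.

Lemma cvg0_of_quadratic_decay (F : R -> R) (s : nat -> R) (M : R) :
  (forall n, s n ^+ 2 = n.+1%:R ^+ 2) ->
  (forall t, `|F t| <= M / (1 + t ^+ 2)) -> F (s n) @[n --> \oo] --> 0.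
Proof.
move=> hs hF; have M0 : 0 <= M.
  by have := hF 0; rewrite expr0n/= addr0 divr1; exact: le_trans.
have hb n : `|F (s n)| <= M * n.+1%:R^-1.
  apply: (le_trans (hF _)); rewrite ler_wpM2l// hs lef_pV2 ?posrE//.
  have : (1 : R) <= n.+1%:R by rewrite ler1n.
  by set k := n.+1%:R => k1; nra.
have h0 : M * n.+1%:R^-1 @[n --> \oo] --> (0 : R).
  by rewrite -[X in _ --> X](mulr0 M); apply: cvgMr; exact: cvg_harmonic.
apply: (@squeeze_cvgr _ _ _ _ (fun n => - (M * n.+1%:R^-1)) (fun n => M * n.+1%:R^-1)).
- by apply: nearW => n; rewrite -ler_norml.
- by rewrite -oppr0; apply: cvgN.
- exact: h0.
Qed.

(** The integrand is the derivative of
    [(al + be t) exp (- (c + 2 t b + t^2 A) / 2)], which is what an affine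
    function times a Gaussian looks like along a line. The exponential is at most
    a multiple of [exp (- A t^2 / 4)]. *)
Lemma gauss_slice_eq0 (A b c al be : R) : 0 < A ->
  (\int[leb]_t ((be - (al + be * t) * (b + A * t)) *
     expR (- (c + 2 * t * b + t ^+ 2 * A) / 2))%:E = 0)%E.
Proof.
move=> A0.
pose F t : R := (al + be * t) * expR (- (c + 2 * t * b + t ^+ 2 * A) / 2).
pose a := A / 4; have a0 : 0 < a by rewrite divr_gt0.
(* [b^2 / A] is the cost of absorbing the linear term [t b] into half of the
   quadratic term *)
pose K := expR (- c / 2 + b ^+ 2 / A); have K0 : 0 < K by exact: expR_gt0.
have hE t : expR (- (c + 2 * t * b + t ^+ 2 * A) / 2) <= K * expR (- a * t ^+ 2).
  rewrite -expRD ler_expR -subr_ge0.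
  have -> : - c / 2 + b ^+ 2 / A + - a * t ^+ 2 - - (c + 2 * t * b + t ^+ 2 * A) / 2 =
    A^-1 * (b + A / 2 * t) ^+ 2 by rewrite /a; field; rewrite gt_eqF.
  by rewrite mulr_ge0 ?sqr_ge0// invr_ge0 ltW.
have t1 (t : R) : `|t| <= 1 + t ^+ 2.
  by rewrite -(real_normK (num_real t)); have := normr_ge0 t; nra.
have lin (x y t : R) : `|x + y * t| <= (`|x| + `|y|) * (1 + t ^+ 2).
  apply: (le_trans (ler_normD _ _)); rewrite normrM mulrDl lerD//.
    by rewrite ler_peMr// lerDl sqr_ge0.
  by rewrite ler_wpM2l.
pose k := (1 + 4 / a) ^+ 2; have k0 : 0 <= k by rewrite sqr_ge0.
have pe t : (1 + t ^+ 2) ^+ 2 * expR (- a * t ^+ 2) <= k * expR (- (a / 2) * t ^+ 2).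
  by apply: poly_expR_le => //; exact: sqr_ge0.
have one t : 1 <= 1 + t ^+ 2 :> R by rewrite lerDl sqr_ge0.
pose M1 := `|al| + `|be|; have M10 : 0 <= M1 by rewrite addr_ge0.
have FM t : `|F t| <= (M1 * K * k) / (1 + t ^+ 2).
  rewrite ler_pdivlMr ?(lt_le_trans ltr01)// /F normrM (ger0_norm (expR_ge0 _)).
  apply: (@le_trans _ _ (M1 * (1 + t ^+ 2) * (K * expR (- a * t ^+ 2)) * (1 + t ^+ 2))).
    rewrite ler_wpM2r ?(le_trans ler01)// ler_pM ?expR_ge0//; exact: lin.
  have -> : M1 * (1 + t ^+ 2) * (K * expR (- a * t ^+ 2)) * (1 + t ^+ 2) =
    M1 * K * ((1 + t ^+ 2) ^+ 2 * expR (- a * t ^+ 2)) by ring.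
  rewrite ler_wpM2l ?mulr_ge0 ?(ltW K0)// (le_trans (pe t))// ler_piMr//.
  by rewrite -expR0 ler_expR mulNr oppr_le0 mulr_ge0 ?sqr_ge0// divr_ge0// ltW.
have cf : continuous (fun t : R => (be - (al + be * t) * (b + A * t)) *
     expR (- (c + 2 * t * b + t ^+ 2 * A) / 2)).
  by move=> t; apply: differentiable_continuous; apply/derivable1_diffP.
apply: (@integral_derive_eq0 F).
- exact: cf.
- move=> t; rewrite /F; apply: is_derive_eq.
  by rewrite /GRing.scale/=; field.
- pose M2 := `|be| + M1 * (`|b| + `|A|); have M20 : 0 <= M2.
    by rewrite addr_ge0// mulr_ge0// addr_ge0.
  have h := integrable_gauss1 (divr_gt0 a0 (ltr0Sn R 1)).
  have {}h : leb.-integrable setT (fun t =>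
     (M2 * K * k)%:E * (expR (- (a / 2) * t ^+ 2))%:E)%E.
    exact: integrableZl h.
  apply: le_integrable h => //.
    by apply/measurable_EFinP; exact: continuous_measurable_fun.
  move=> t _ /=; rewrite lee_fin normrM (ger0_norm (expR_ge0 _)).
  rewrite [leRHS]ger0_norm; last first.
    exact: mulr_ge0 (mulr_ge0 (mulr_ge0 M20 (ltW K0)) k0) (expR_ge0 _).
  apply: (@le_trans _ _ (M2 * (1 + t ^+ 2) ^+ 2 * (K * expR (- a * t ^+ 2)))).
    apply: ler_pM; rewrite ?expR_ge0//.
    apply: (le_trans (ler_normB _ _)); rewrite normrM mulrDl lerD//.
      by rewrite ler_peMr// exprn_ege1.
    apply: (le_trans (ler_pM _ _ (lin _ _ _) (lin _ _ _))) => //.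
    by rewrite -/M1 mulrACA -expr2.
  have -> : M2 * (1 + t ^+ 2) ^+ 2 * (K * expR (- a * t ^+ 2)) =
    M2 * K * ((1 + t ^+ 2) ^+ 2 * expR (- a * t ^+ 2)) by ring.
  by rewrite -(mulrA (M2 * K) k) ler_wpM2l// mulr_ge0// ltW.
- exact: (@cvg0_of_quadratic_decay F (fun n => n.+1%:R) _ (fun n => erefl) FM).
- exact: (@cvg0_of_quadratic_decay F (fun n => - n.+1%:R) _ (fun n => sqrrN _) FM).
Qed.
End line.

(** * Integrals against a measure with a density *)

Section density.
Local Open Scope ereal_scope.
Context d (T : measurableType d) (R : realType).
Variable mu : {sigma_finite_measure set T -> \bar R}.
Variable phi : T -> R.
Hypothesis phi0 : forall x, (0 <= phi x)%R.
Hypothesis iphi : mu.-integrable setT (EFin \o phi).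

Let mphi : measurable_fun setT (EFin \o phi).
Proof. exact: measurable_int iphi. Qed.

(** The density agrees almost everywhere with the Radon-Nikodym derivative, for
    which the change of variables is known. *)
Lemma ge0_integral_density_measure (nu : {finite_measure set T -> \bar R})
    (f : T -> \bar R) :
  (forall A, measurable A -> nu A = \int[mu]_(x in A) (phi x)%:E) ->
  measurable_fun setT f -> (forall x, 0 <= f x) ->
  \int[nu]_x f x = \int[mu]_x (f x * (phi x)%:E).
Proof.
move=> nuE mf f0.
have numu : nu `<< mu.
  apply/null_content_dominatesP => A mA A0; rewrite nuE//.
  apply: null_set_integral => //.
  exact: measurable_funTS.
rewrite -(Radon_Nikodym_SigmaFinite.change_of_variables numu)//.
have iRN := Radon_Nikodym_SigmaFinite.f_integrable numu.
have mRN : measurable_fun setT (Radon_Nikodym_SigmaFinite.f nu mu).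
  exact: measurable_int iRN.
apply: ae_eq_integral => //; [exact: emeasurable_funM|exact: emeasurable_funM|].
apply: ae_eqe_mul2l; apply: integral_ae_eq => // A _ mA.
by rewrite -nuE// (Radon_Nikodym_SigmaFinite.f_integral numu).
Qed.

Lemma integral_density_measure (nu : {finite_measure set T -> \bar R})
    (f : T -> R) :
  (forall A, measurable A -> nu A = \int[mu]_(x in A) (phi x)%:E) ->
  measurable_fun setT f ->
  \int[nu]_x (f x)%:E = \int[mu]_x (f x * phi x)%:E.
Proof.
move=> nuE mf.
have mfE : measurable_fun setT (EFin \o f) by exact/measurable_EFinP.
rewrite [LHS]integralE [RHS]integralE.
rewrite !(ge0_integral_density_measure nuE)//;
  [|exact: measurable_funeneg|exact: measurable_funepos].
congr (_ - _); apply: eq_integral => x _.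
  rewrite !funeposE -!EFin_max -EFinM maxr_pMl//.
  by rewrite mul0r.
rewrite !funenegE -!EFin_max -EFinM maxr_pMl//.
by rewrite mul0r mulNr.
Qed.

(** The same rule for the bare set function with density [phi], which is what a
    conditional law is given as; it has to be packaged as a finite measure. *)
Lemma integral_induced_density (f : T -> R) : measurable_fun setT f ->
  \int[fun A => \int[mu]_(x in A) (phi x)%:E]_x (f x)%:E =
  \int[mu]_x (f x * phi x)%:E.
Proof.
move=> mf; pose nu A := \int[mu]_(x in A) (phi x)%:E.
have nu0 : nu set0 = 0 by exact: integral_set0.
have nu_ge0 A : 0 <= nu A by apply: integral_ge0 => x _; rewrite lee_fin.
have nuS : semi_sigma_additive nu.
  by apply: semi_sigma_additive_nng_induced => // x; rewrite lee_fin.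
have nuF : fin_num_fun nu.
  by move=> A mA; apply: integrable_fin_num => //; exact: integrableS iphi.
pose M := isMeasure.Build d T R nu nu0 nu_ge0 nuS.
pose nuM : {measure set T -> \bar R} := HB.pack nu M.
have nuF' : fin_num_fun nuM by exact: nuF.
pose N := Measure_isFinite.Build d T R nuM nuF'.
pose nuP : {finite_measure set T -> \bar R} := HB.pack nu M N.
exact: (@integral_density_measure nuP).
Qed.
End density.

(** * Integration by parts against Gaussian functions *)

Section gauss.
Context {R : realType}.
Implicit Type n : nat.

(** The Gaussian density with precision matrix [P], up to its normalising
    constant. *)
Definition gauss n (P : 'M[R]_n) (m x : 'rV[R]_n) : R := expR (- qf P (x - m) / 2).

(** Growth of order [|x|^(2 k)]: the class of test functions is stable under sums
    and products, which gives the integrability of all the moments below. *)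
Definition growth n k (g : 'rV[R]_n -> R) : Prop :=
  exists2 M, 0 <= M & forall x, `|g x| <= M * (1 + sqn x) ^+ k.

Lemma growth_le n k l (g : 'rV[R]_n -> R) : (k <= l)%N -> growth k g -> growth l g.
Proof.
move=> kl [M M0 hM]; exists M => // x; apply: (le_trans (hM x)).
by rewrite ler_wpM2l// ler_weXn2l// lerDl sqn_ge0.
Qed.

Lemma growthD n k (f g : 'rV[R]_n -> R) : growth k f -> growth k g ->
  growth k (fun x => f x + g x).
Proof.
move=> [M M0 hM] [N N0 hN]; exists (M + N); first exact: addr_ge0.
by move=> x; rewrite (le_trans (ler_normD _ _))// mulrDl lerD.
Qed.

Lemma growthN n k (f : 'rV[R]_n -> R) : growth k f -> growth k (fun x => - f x).
Proof. by move=> [M M0 hM]; exists M => // x; rewrite normrN. Qed.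

Lemma growthM n k l (f g : 'rV[R]_n -> R) : growth k f -> growth l g ->
  growth (k + l) (fun x => f x * g x).
Proof.
move=> [M M0 hM] [N N0 hN]; exists (M * N); first exact: mulr_ge0.
by move=> x; rewrite normrM exprD mulrACA ler_pM.
Qed.

Lemma growth_cst n (c : R) : growth 0 (fun=> c : R) (n := n).
Proof. by exists `|c| => // x; rewrite expr0 mulr1. Qed.

Lemma growth_coord n i : growth 1 (fun x : 'rV[R]_n => x 0 i).
Proof.
exists 1 => // x; rewrite mul1r expr1.
have := coord_le_sqn x i; rewrite -(real_normK (num_real (x 0 i))).
by have := normr_ge0 (x 0 i); nra.
Qed.

Lemma growth_mulmx n k (A : 'M[R]_(n, k)) (m : 'rV[R]_n) j :
  growth 1 (fun x => ((x - m) *m A) 0 j).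
Proof.
suff H (s : seq 'I_n) : growth 1 (fun x : 'rV[R]_n => \sum_(i <- s) (x - m) 0 i * A i j).
  have [M M0 hM] := H (index_enum 'I_n).
  by exists M => // x; rewrite mxE.
elim: s => [|i s [M M0 IH]].
  by exists 0 => // x; rewrite big_nil normr0 mul0r.
have [N N0 hN] : growth 1 (fun x : 'rV[R]_n => (x - m) 0 i * A i j).
  rewrite -[1%N]/(1 + 0)%N; apply: growthM; last exact: growth_cst.
  have [M' M'0 h] : growth 1 (fun x : 'rV[R]_n => x 0 i - m 0 i).
    apply: growthD; first exact: growth_coord.
    exact: growth_le (growth_cst _ _).
  by exists M' => // x; rewrite !mxE.
exists (N + M); first exact: addr_ge0.
by move=> x; rewrite big_cons (le_trans (ler_normD _ _))// mulrDl lerD.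
Qed.

Lemma gauss_ge0 n (P : 'M[R]_n) m x : 0 <= gauss P m x.
Proof. exact: expR_ge0. Qed.

Lemma measurable_gauss n (P : 'M[R]_n) m : measurable_fun setT (gauss P m).
Proof.
apply: measurableT_comp => //; apply: measurable_funM => //.
by apply: measurableT_comp => //; exact: measurable_qf.
Qed.

Lemma gauss_le n (P : 'M[R]_n) a m x : 0 <= a ->
  (forall v, a * sqn v <= qf P v) ->
  gauss P m x <= expR (a / 2 * sqn m) * expR (- (a / 4) * sqn x).
Proof.
move=> a0 aP; rewrite -expRD ler_expR.
have := aP (x - m); have : sqn x <= 2 * sqn (x - m) + 2 * sqn m.
  by rewrite -{1}(subrK m x) sqnD.
move: (sqn x) (sqn (x - m)) (sqn m) (qf P _) => s t u q; nra.
Qed.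

Lemma integrable_growth_gauss n (P : 'M[R]_n) a m g : 0 < a ->
  (forall v, a * sqn v <= qf P v) -> measurable_fun setT g -> growth 2 g ->
  (lebesgue_rV n).-integrable setT (fun x => (g x * gauss P m x)%:E).
Proof.
move=> a0 aP mg [M M0 hM].
apply: (@integrable_poly_gauss _ _ (a / 4) (M * expR (a / 2 * sqn m))) => //.
- by rewrite divr_gt0.
- by rewrite mulr_ge0// expR_ge0.
- by apply: measurable_funM => //; exact: measurable_gauss.
- move=> x; rewrite normrM (ger0_norm (gauss_ge0 _ _ _)).
  by rewrite mulrACA ler_pM ?gauss_ge0// gauss_le// ltW.
Qed.

(** Integration by parts against a Gaussian: the integrand is the derivative along
    [e_i] of [(al + (x - m) l) * gauss P m x]. Having the affine factor general
    covers both the first moments ([l = 0], [al = 1]) and the second ones. *)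
Lemma gauss_ibp n (P : 'M[R]_n) a m (i : 'I_n) (al : R) (l : 'cV[R]_n) :
  P^T = P -> 0 < a ->
  (forall v, a * sqn v <= qf P v) ->
  (\int[lebesgue_rV n]_x ((l i 0 - (al + ((x - m) *m l) 0 0) * ((x - m) *m P) 0 i) *
     gauss P m x)%:E = 0)%E.
Proof.
move=> sP a0 aP; apply: (@integral_eq0_along_lines _ _ i).
  apply: (integrable_growth_gauss _ a0 aP).
    apply: measurable_funB => //; apply: measurable_funM.
      apply: measurable_funD => //.
      under eq_fun do rewrite mulmxBl mxE; apply: measurable_funD => //.
      exact: measurable_mulmx.
    under eq_fun do rewrite mulmxBl mxE; apply: measurable_funD => //.
    exact: measurable_mulmx.
  apply: growthD; first exact: growth_le (growth_cst _ _).
  apply: growthN; rewrite -[2%N]/(1 + 1)%N; apply: growthM; last exact: growth_mulmx.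
  apply: growthD; last exact: growth_mulmx.
  exact: growth_le (growth_cst _ _).
move=> x; set z := x - m.
have Pii : 0 < P i i.
  rewrite -qf_delta; apply: lt_le_trans (aP _); rewrite mulr_gt0// sqn_gt0//.
  apply/eqP => /rowP/(_ i); rewrite !mxE !eqxx; apply/eqP; exact: oner_neq0.
rewrite -[RHS](gauss_slice_eq0 ((z *m P) 0 i) (qf P z) (al + (z *m l) 0 0) (l i 0) Pii).
apply: eq_integral => t _.
rewrite /gauss; have -> : x + t *: 'e_i - m = z + t *: 'e_i by rewrite addrAC.
clearbody z.
congr ((_ * expR (- _ / 2))%:E).
  have e k (A : 'M[R]_(n, k)) j : ((z + t *: 'e_i) *m A) 0 j = (z *m A) 0 j + t * A i j.
    by rewrite mulmxDl -scalemxAl -rowE mxE; congr (_ + _); rewrite !mxE.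
  rewrite !e; ring.
rewrite /qf !(bilDl, bilDr, bilZl, bilZr) (bilC 'e_i z sP) -/(qf P 'e_i).
rewrite qf_delta bil_delta -/(qf P z); ring.
Qed.
End gauss.

(** * Moments of a Gaussian measure *)

Section moments.
Context {R : realType}.
Variables (n : nat) (mu : probability 'rV[R]_n R) (m : 'rV[R]_n) (C : 'M[R]_n).
Hypotheses (pC : pd C) (dmu : density mu (gaussian_pdf m C)).
Let P := invmx C.
Let N := Num.sqrt ((2 * pi) ^+ n * \det C).

Lemma gaussian_pdfE x : gaussian_pdf m C x = N^-1 * gauss P m x.
Proof. by rewrite mulrC. Qed.

Lemma integrable_gaussian_pdf : (lebesgue_rV n).-integrable setT
  (fun x => (gaussian_pdf m C x)%:E).
Proof.
have [mphi phi0 hmu] := dmu; apply/integrableP; split.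
  exact: measurable_EFin_rV.
under eq_integral do rewrite gee0_abs ?lee_fin//.
by rewrite -hmu// probability_setT ltry.
Qed.

(** A vanishing constant would make the density zero, by the convention on
    inverses, contradicting total mass one. *)
Lemma gaussian_normalizer_gt0 : 0 < N.
Proof.
rewrite lt_def sqrtr_ge0 andbT; apply/eqP => N0.
have [_ _ /(_ setT measurableT)] := dmu.
under eq_integral do rewrite gaussian_pdfE N0 invr0 mul0r.
by rewrite integral0 probability_setT => /eqP; rewrite eqe oner_eq0.
Qed.

Lemma integral_gaussian f : measurable_fun setT f ->
  (\int[mu]_x (f x)%:E = \int[lebesgue_rV n]_x (f x * gaussian_pdf m C x)%:E)%E.
Proof.
have [mphi phi0 hmu] := dmu; move=> mf.
by apply: integral_density_measure => //; exact: integrable_gaussian_pdf.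
Qed.

Lemma integrable_gaussian f : measurable_fun setT f -> growth 2 f ->
  mu.-integrable setT (fun x => (f x)%:E).
Proof.
have [mphi phi0 hmu] := dmu; move=> mf gf.
apply/integrableP; split; first exact: measurable_EFin_rV.
have mnf : measurable_fun setT (fun x => `|f x|) by exact: measurableT_comp.
rewrite [ltLHS](integral_gaussian mnf).
have [a a0 aP] := pd_inv_lower pC.
have /integrableP[_] := integrable_growth_gauss m a0 aP mf gf.
have -> : (\int[lebesgue_rV n]_x (`|f x| * gaussian_pdf m C x)%:E =
  N^-1%:E * \int[lebesgue_rV n]_x `|(f x * gauss P m x)%:E|)%E.
  rewrite -ge0_integralZl//=.
  - apply: eq_integral => x _; rewrite gaussian_pdfE -EFinM; congr EFin.
    by rewrite normrM (ger0_norm (gauss_ge0 _ _ _)) mulrCA.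
  - apply: measurable_EFin_rV; apply: measurableT_comp => //.
    by apply: measurable_funM => //; exact: measurable_gauss.
  - by rewrite lee_fin invr_ge0 sqrtr_ge0.
by move=> h; rewrite lte_mul_pinfty// lee_fin invr_ge0 sqrtr_ge0.
Qed.

Lemma integral_gaussian_cst (c : R) : (\int[mu]_x c%:E = c%:E)%E.
Proof.
rewrite integral_cst// -[RHS]mule1; congr (_ * _)%E; exact: probability_setT.
Qed.

Let mz k (A : 'M[R]_(n, k)) j :
  measurable_fun setT (fun x : 'rV[R]_n => ((x - m) *m A) 0 j).
Proof.
under eq_fun do rewrite mulmxBl mxE; apply: measurable_funD => //.
exact: measurable_mulmx.
Qed.

Let g1 al (l : 'cV[R]_n) :
  growth 1 (fun x : 'rV[R]_n => al + ((x - m) *m l) 0 0).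
Proof.
by apply: growthD; [exact: growth_le (growth_cst _ _)|exact: growth_mulmx].
Qed.

Let mg1 al (l : 'cV[R]_n) :
  measurable_fun setT (fun x : 'rV[R]_n => al + ((x - m) *m l) 0 0).
Proof. by apply: measurable_funD => //; exact: mz. Qed.

Lemma integrable_gaussian_stein (al : R) (l : 'cV[R]_n) i : mu.-integrable setT
  (fun x : 'rV[R]_n => ((al + ((x - m) *m l) 0 0) * ((x - m) *m P) 0 i)%:E).
Proof.
apply: integrable_gaussian; first exact: measurable_funM.
rewrite -[2%N]/(1 + 1)%N; apply: growthM; last exact: growth_mulmx.
exact: g1.
Qed.

(** Stein's identity, [gauss_ibp] after normalisation. *)
Lemma gaussian_stein (al : R) (l : 'cV[R]_n) i :
  (\int[mu]_x ((al + ((x - m) *m l) 0 0) * ((x - m) *m P) 0 i)%:E = (l i 0)%:E)%E.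
Proof.
set F := fun x => _.
have iF : mu.-integrable setT F by exact: integrable_gaussian_stein.
have ic : mu.-integrable setT (fun x => (l i 0)%:E).
  by apply: integrable_gaussian => //; exact: growth_le (growth_cst _ _).
have [a a0 aP] := pd_inv_lower pC.
have sP : P^T = P by apply: invmx_sym; case: pC.
have h0 := gauss_ibp m i al l sP a0 aP.
have h : (\int[mu]_x ((l i 0)%:E - F x) = 0)%E.
  transitivity (\int[mu]_x ((l i 0) - (al + ((x - m) *m l) 0 0) * ((x - m) *m P) 0 i)%:E)%E.
    by [].
  rewrite integral_gaussian; last first.
    by apply: measurable_funB => //; exact: measurable_funM.
  under eq_integral do rewrite gaussian_pdfE mulrCA EFinM.
  rewrite integralZl ?h0 ?mule0//.
  apply: (integrable_growth_gauss _ a0 aP); first by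
    apply: measurable_funB => //; exact: measurable_funM.
  apply: growthD; first exact: growth_le (growth_cst _ _).
  apply: growthN; rewrite -[2%N]/(1 + 1)%N; apply: growthM; last exact: growth_mulmx.
  exact: g1.
move: h; rewrite integralB//= integral_gaussian_cst.
have := integrable_fin_num measurableT iF.
rewrite /F; case: (\int[mu]_x _)%E => //= r _ [] /eqP.
by rewrite subr_eq0 => /eqP ->.
Qed.

(** Stein's identity gives the moments of [(x - m) P]; multiplying by [C = P^-1]
    gives those of [x - m]. *)
Lemma gaussian_moment2 (al : R) (l : 'cV[R]_n) k :
  (\int[mu]_x ((al + ((x - m) *m l) 0 0) * (x 0 k - m 0 k))%:E =
     (\sum_i l i 0 * C i k)%:E)%E.
Proof.
transitivity (\int[mu]_x \sum_i ((C i k)%:E *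
   ((al + ((x - m) *m l) 0 0) * ((x - m) *m P) 0 i)%:E))%E.
  apply: eq_integral => x _; rewrite sumEFin; congr EFin.
  have -> : x 0 k - m 0 k = (x - m) 0 k by rewrite !mxE.
  have {2}-> : x - m = (x - m) *m P *m C by rewrite mulmxKV// pd_unitmx.
  rewrite [X in _ * X]mxE mulr_sumr; apply: eq_bigr => i _; ring.
rewrite integral_sum//.
  rewrite -sumEFin; apply: eq_bigr => i _.
  rewrite integralZl//= ?gaussian_stein -?EFinM 1?mulrC//.
  exact: integrable_gaussian_stein.
by move=> i; apply: integrableZl => //; exact: integrable_gaussian_stein.
Qed.

Lemma integral_gaussian_coord k : (\int[mu]_x (x 0 k)%:E = (m 0 k)%:E)%E.
Proof.
have := gaussian_moment2 1 0 k.
rewrite [in RHS]big1 => [h|i _]; last by rewrite mxE mul0r.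
have ix : mu.-integrable setT (fun x : 'rV[R]_n => (x 0 k)%:E).
  apply: integrable_gaussian; first exact: (measurable_coord (T := R)).
  exact: growth_le (growth_coord _).
have ic : mu.-integrable setT (fun x => (m 0 k)%:E).
  by apply: integrable_gaussian => //; exact: growth_le (growth_cst _ _).
have {}h : (\int[mu]_x ((x 0 k)%:E - (m 0 k)%:E) = 0)%E.
  rewrite -[RHS]h; apply: eq_integral => x _.
  by rewrite mulmx0 mxE addr0 mul1r.
move: h; rewrite integralB//= integral_gaussian_cst.
have := integrable_fin_num measurableT ix.
case: (\int[mu]_x _)%E => //= r _ [] /eqP.
by rewrite subr_eq0 => /eqP ->.
Qed.

(** [al = m_j] gives the covariance, [al = 0] prepares the uncentred moment. *)
Lemma integral_gaussian_cov al j k :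
  (\int[mu]_x ((x 0 j - al) * (x 0 k - m 0 k))%:E = (C j k)%:E)%E.
Proof.
have := gaussian_moment2 (m 0 j - al) (delta_mx j 0) k.
rewrite (bigD1 j)//= big1 => [|i ij]; last by rewrite mxE (negbTE ij) mul0r.
rewrite mxE !eqxx mul1r addr0 => <-; apply: eq_integral => x _.
rewrite -colE mxE mxE [in RHS]mxE; congr ((_ * _)%:E); ring.
Qed.

Lemma mean_gaussian : mean mu = m.
Proof.
by apply/rowP => i; rewrite mxE unlock integral_gaussian_coord.
Qed.

Lemma cov_gaussian : cov mu = C.
Proof.
apply/matrixP => i j; rewrite mxE unlock.
have e k : 'E_mu[fun x => x ord0 k]%E = (m 0 k)%:E.
  by rewrite unlock; exact: integral_gaussian_coord.
rewrite !e/= unlock; exact: (congr1 fine (integral_gaussian_cov _ _ _)).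
Qed.

Lemma integral_gaussian_coordM j k :
  (\int[mu]_x (x 0 j * x 0 k)%:E = (C j k + m 0 j * m 0 k)%:E)%E.
Proof.
have i1 : mu.-integrable setT (fun x : 'rV[R]_n => (m 0 k * x 0 j)%:E).
  apply: integrable_gaussian.
    by apply: measurable_funM => //; exact: (measurable_coord (T := R)).
  rewrite -[2%N]/(1 + 1)%N; apply: growthM; last exact: growth_coord.
  exact: growth_le (growth_cst _ _).
have i0 : mu.-integrable setT (fun x : 'rV[R]_n => (x 0 j)%:E).
  apply: integrable_gaussian; first exact: (measurable_coord (T := R)).
  exact: growth_le (growth_coord _).
have i2 : mu.-integrable setT (fun x : 'rV[R]_n => ((x 0 j - 0) * (x 0 k - m 0 k))%:E).
  apply: integrable_gaussian.
    by apply: measurable_funM; apply: measurable_funB => //;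
       exact: (measurable_coord (T := R)).
  rewrite -[2%N]/(1 + 1)%N; apply: growthM;
    by apply: growthD; [exact: growth_coord|exact: growth_le (growth_cst _ _)].
transitivity (\int[mu]_x (((x 0 j - 0) * (x 0 k - m 0 k))%:E + (m 0 k * x 0 j)%:E))%E.
  by apply: eq_integral => x _; rewrite -EFinD; congr EFin; ring.
rewrite integralD// integral_gaussian_cov.
under eq_integral do rewrite EFinM.
by rewrite integralZl// integral_gaussian_coord -EFinM -EFinD (mulrC (m 0 k)).
Qed.

End moments.

(** * Uniqueness of the continuous density *)

Section continuous_density.
Context {R : realType}.
Implicit Type n : nat.

(** The balls of the maximum norm, as products of intervals. *)
Definition box n (x : 'rV[R]_n) e : set 'rV[R]_n :=
  [set y | forall i, ball (x 0 i) e (y 0 i)].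

Lemma measurable_box n (x : 'rV[R]_n) e : measurable (box x e).
Proof.
have -> : box x e = \bigcap_(i in [set: 'I_n])
    ((fun y : 'rV[R]_n => y 0 i) @^-1` ball (x 0 i) e).
  by apply/seteqP; split => [y By i _|y By i]; exact: By.
apply: fin_bigcap_measurable; first exact: finite_finset.
move=> i _; rewrite -[X in measurable X]setTI.
by apply: (measurable_coord (T := R)) => //; exact: measurable_ball.
Qed.

Lemma lebesgue_rV_box n (x : 'rV[R]_n) e : 0 < e ->
  lebesgue_rV n (box x e) = ((e *+ 2) ^+ n)%:E.
Proof.
move=> e0; elim: n x => [|n IH] x.
  rewrite expr0 /= diracE mem_set//; by case.
transitivity ((@lebesgue_measure R \x lebesgue_rV n)%E
   (ball (x 0 0) e `*` box (\row_i x 0 (lift ord0 i)) e)).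
  rewrite /=/lebesgue_succ/= /pushforward; congr (_ _).
  apply/seteqP; split => -[t y] /=.
    move=> By; split => [|i /=]; first by have := By 0; rewrite cons_rV0.
    by have := By (lift ord0 i); rewrite cons_rVS mxE.
  move=> [/= tx yx] i; case: (unliftP ord0 i) => [j ->|->].
    by rewrite cons_rVS; have := yx j; rewrite mxE.
  by rewrite cons_rV0.
rewrite product_measure1E//; last exact: measurable_box.
  rewrite IH exprS EFinM; congr (_ * _)%E.
  exact: lebesgue_measure_ball (ltW e0).
exact: measurable_ball.
Qed.

(** Two densities agree almost everywhere, and a strict inequality between
    continuous functions at a point persists on a box, which is not negligible. *)
Lemma continuous_density_le n (mu : probability 'rV[R]_n R) f g :
  continuous f -> density mu f -> continuous g -> density mu g ->
  forall x, f x <= g x.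
Proof.
move=> cf [mf f0 muf] cg [mg g0 mug] x; rewrite leNgt; apply/negP => gf.
have iphi (h : 'rV[R]_n -> R) : measurable_fun setT h -> (forall x, 0 <= h x) ->
    (forall A, measurable A -> mu A = (\int[lebesgue_rV n]_(x in A) (h x)%:E)%E) ->
    (lebesgue_rV n).-integrable setT (fun x => (h x)%:E).
  move=> mh h0 muh; apply/integrableP; split; first exact: measurable_EFin_rV.
  under eq_integral do rewrite gee0_abs ?lee_fin//.
  by rewrite -muh// probability_setT ltry.
have : ae_eq (lebesgue_rV n) setT (fun x => (f x)%:E) (fun x => (g x)%:E).
  apply: integral_ae_eq => //; first exact: iphi.
    exact: measurable_EFin_rV.
  by move=> A _ mA; rewrite -muf// -mug.
move=> [A [mA A0 AE]].
have : nbhs x [set y | g y < f y].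
  have cgf : {for x, continuous (fun y : 'rV[R]_n => f y - g y)}.
    by apply: (@continuousB _ _ 'rV[R]_n); [exact: cf|exact: cg].
  have fgx : 0 < f x - g x by rewrite subr_gt0.
  have -> : [set y | g y < f y] = (fun y => f y - g y) @^-1` [set t | 0 < t].
    by apply/funext => y /=; rewrite subr_gt0.
  exact: cgf _ (open_nbhs_nbhs (conj (@open_gt R 0) fgx)).
move=> /nbhs_ballP[e /= e0 Be].
have : (lebesgue_rV n (box x e) <= lebesgue_rV n A)%E.
  apply: le_measure; rewrite ?inE//; first exact: measurable_box.
  apply: subset_trans AE => y By /= /(_ I) [] fgy.
  have /Be : ball x e y.
    split => // i j; rewrite [i]ord1; exact: By.
  by rewrite /= fgy ltxx.
by rewrite A0 lebesgue_rV_box// lee_fin leNgt exprn_gt0// pmulrn_lgt0.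
Qed.

Lemma continuous_coord n i : continuous (fun x : 'rV[R]_n => x 0 i).
Proof. by move=> x; exact: coord_continuous. Qed.

Lemma continuous_gaussian_pdf n (m : 'rV[R]_n) C : continuous (gaussian_pdf m C).
Proof.
have cz i : continuous (fun x : 'rV[R]_n => (x - m) 0 i).
  under eq_fun do rewrite mxE.
  move=> x; apply: (@continuousD _ _ 'rV[R]_n); first exact: continuous_coord.
  exact: cst_continuous.
have csum (F : 'I_n -> 'rV[R]_n -> R) : (forall i, continuous (F i)) ->
    continuous (fun x => \sum_i F i x).
  move=> cF; apply: (@continuous_big _ _ +%R 0 xpredT _ _ _ F) => //.
  by move=> z; apply: cvgD; [exact: cvg_fst|exact: cvg_snd].
have cA j : continuous (fun x : 'rV[R]_n => ((x - m) *m invmx C) 0 j).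
  under eq_fun do rewrite mxE.
  apply: csum => i x; apply: (@continuousM _ 'rV[R]_n); first exact: cz.
  exact: cst_continuous.
have cq : continuous (fun x : 'rV[R]_n => ((x - m) *m invmx C *m (x - m)^T) 0 0).
  under eq_fun do rewrite mxE.
  apply: csum => j x; apply: (@continuousM _ 'rV[R]_n); first exact: cA.
  have -> : (fun x : 'rV[R]_n => (x - m)^T j 0) = (fun x => (x - m) 0 j).
    by apply/funext => y; rewrite mxE.
  exact: cz.
move=> x; apply: (@continuousM _ 'rV[R]_n); last exact: cst_continuous.
apply: (@continuous_comp 'rV[R]_n R R); last exact: continuous_expR.
apply: (@continuousM _ 'rV[R]_n); last exact: cst_continuous.
by apply: (@continuousN _ _ 'rV[R]_n); exact: cq.
Qed.

Lemma cdensity_gaussian n (mu : probability 'rV[R]_n R) m C :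
  density mu (gaussian_pdf m C) -> cdensity mu = gaussian_pdf m C.
Proof.
move=> dmu; apply: xget_unique; first by split => //; exact: continuous_gaussian_pdf.
move=> f [cf df]; apply/funext => x; apply/eqP; rewrite eq_le.
have cg := @continuous_gaussian_pdf n m C.
by rewrite (continuous_density_le cf df cg dmu) (continuous_density_le cg dmu cf df).
Qed.
End continuous_density.

(** * Lipschitz dependence of quotients of integrals *)

Section stability.
Context {R : realType}.
Implicit Type n : nat.

Lemma expR_diff_le (s t : R) :
  `|expR s - expR t| <= `|s - t| * (expR s + expR t).
Proof.
wlog st : s t / t <= s.
  move=> H; have [/H//|/ltW/H] := leP t s.
  by rewrite distrC (distrC t) (addrC (expR t)).
rewrite !ger0_norm ?subr_ge0 ?ler_expR//.
have := expR_ge1Dx (t - s); rewrite expRD expRN => h.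
have : (1 + (t - s)) * expR s <= expR t / expR s * expR s.
  by rewrite ler_wpM2r// expR_ge0.
rewrite divfK ?gt_eqF ?expR_gt0//.
have := expR_ge0 t; have : 0 <= s - t by rewrite subr_ge0.
move: (expR s) (expR t) => p q; nra.
Qed.

(** A bound, by [poly_expR_le], for the integral of
    [(1 + |x|^2)^2 exp (- b |x|^2)]. *)
Definition poly_gauss_mass n (b : R) : R :=
  (1 + 4 / b) ^+ 2 * \int[lebesgue_rV n]_x expR (- (b / 2) * sqn x).

Lemma poly_gauss_mass_ge0 n b : 0 <= poly_gauss_mass n b.
Proof.
by rewrite mulr_ge0 ?sqr_ge0//; apply: Rintegral_ge0 => x _; exact: expR_ge0.
Qed.

Lemma Rintegral_poly_gauss_le n (b M : R) (F : 'rV[R]_n -> R) : 0 < b -> 0 <= M ->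
  measurable_fun setT F ->
  (forall x, `|F x| <= M * ((1 + sqn x) ^+ 2 * expR (- b * sqn x))) ->
  `|\int[lebesgue_rV n]_x F x| <= M * poly_gauss_mass n b.
Proof.
move=> b0 M0 mF hF; have iF := integrable_poly_gauss b0 M0 mF hF.
apply: (le_trans (le_normr_Rintegral _ iF)) => //.
have ig := integrable_gauss_rV n (divr_gt0 b0 (ltr0Sn R 1)).
rewrite mulrA -RintegralZl//; apply: le_Rintegral => //.
- exact: integrable_norm iF.
- exact: integrableZl ig.
- move=> x _; apply: (le_trans (hF x)); rewrite -(mulrA M) ler_wpM2l//.
  by apply: poly_expR_le => //; exact: sqn_ge0.
Qed.

(** Quotients [X / Z] and [X' / Z'] of integrals are compared through
    [(X - X') / Z - X' (Z - Z') / (Z Z')]: this needs closeness of the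
    integrands, a bound on [X'] and a lower bound on the denominators. *)
Lemma ratio_lipschitz n (b B c D z : R) (E E' f : 'rV[R]_n -> R) :
  0 < b -> 0 <= B -> 0 <= c -> 0 <= D -> 0 < z ->
  measurable_fun setT E -> measurable_fun setT E' -> measurable_fun setT f ->
  (forall x, `|E x| <= B * expR (- b * sqn x)) ->
  (forall x, `|E' x| <= B * expR (- b * sqn x)) ->
  (forall x, `|E x - E' x| <= D * c * ((1 + sqn x) * expR (- b * sqn x))) ->
  (forall x, `|f x| <= 1 + sqn x) ->
  let Z := \int[lebesgue_rV n]_x E x in
  let Z' := \int[lebesgue_rV n]_x E' x in
  z <= Z -> z <= Z' ->
  `|(\int[lebesgue_rV n]_x (f x * E x)) / Z -
    (\int[lebesgue_rV n]_x (f x * E' x)) / Z'|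
    <= (c * poly_gauss_mass n b / z +
        B * poly_gauss_mass n b * (c * poly_gauss_mass n b) / z ^+ 2) * D.
Proof.
move=> b0 B0 c0 D0 z0 mE mE' mf hE hE' hEE hf Z Z' zZ zZ'.
have s1 x : 1 <= 1 + sqn (x : 'rV[R]_n) by rewrite lerDl sqn_ge0.
have hmul (g G : 'rV[R]_n -> R) : 
  (forall x, `|g x| <= 1 + sqn x) -> (forall x, `|G x| <= B * expR (- b * sqn x)) ->
   forall x, `|g x * G x| <= B * ((1 + sqn x) ^+ 2 * expR (- b * sqn x)).
  move=> hg hG x; rewrite normrM mulrCA; apply: ler_pM => //.
  by rewrite (le_trans (hg x))// expr2 ler_peMr// (le_trans ler01).
have m1 (g G : 'rV[R]_n -> R) : measurable_fun setT g -> measurable_fun setT G ->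
  measurable_fun setT (fun x => g x * G x) by move=> *; exact: measurable_funM.
have i1 (g G : 'rV[R]_n -> R) : 
  (forall x, `|g x| <= 1 + sqn x) -> (forall x, `|G x| <= B * expR (- b * sqn x)) ->
   measurable_fun setT g -> measurable_fun setT G ->
   (lebesgue_rV n).-integrable setT (EFin \o (fun x => g x * G x)).
  move=> hg hG mg mG; apply: (@integrable_poly_gauss _ _ b B) => //; first exact: m1.
  exact: hmul.
have diff (g : 'rV[R]_n -> R) : measurable_fun setT g -> (forall x, `|g x| <= 1 + sqn x) ->
  `|\int[lebesgue_rV n]_x (g x * E x) - \int[lebesgue_rV n]_x (g x * E' x)|
    <= D * c * poly_gauss_mass n b.
  move=> mg hg; rewrite -RintegralB//; [|exact: i1|exact: i1].
  apply: Rintegral_poly_gauss_le => //; first exact: mulr_ge0.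
    by apply: measurable_funB; exact: m1.
  move=> x; rewrite -mulrBr normrM.
  have -> : D * c * ((1 + sqn x) ^+ 2 * expR (- b * sqn x)) =
     (1 + sqn x) * (D * c * ((1 + sqn x) * expR (- b * sqn x))) by ring.
  exact: ler_pM.
have hZ : `|Z - Z'| <= D * c * poly_gauss_mass n b.
  have h1 (x : 'rV[R]_n) : `|1 : R| <= 1 + sqn x by rewrite normr1.
  have mc : measurable_fun setT (fun _ : 'rV[R]_n => 1 : R) by exact: measurable_cst.
  have e (G : 'rV[R]_n -> R) : \int[lebesgue_rV n]_x (1 * G x) = \int[lebesgue_rV n]_x G x.
    by apply: eq_Rintegral => x _; rewrite mul1r.
  by have := diff _ mc h1; rewrite !e.
have hX := diff f mf hf.
have hX' : `|\int[lebesgue_rV n]_x (f x * E' x)| <= B * poly_gauss_mass n b.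
  by apply: Rintegral_poly_gauss_le => //; [exact: m1|exact: hmul].
move: hX hX'; set X := Rintegral _ _ _; set X' := Rintegral _ _ _ => hX hX'.
have Z0 : 0 < Z by exact: lt_le_trans zZ.
have Z0' : 0 < Z' by exact: lt_le_trans zZ'.
have -> : X / Z - X' / Z' = (X - X') / Z - X' * (Z - Z') / (Z * Z').
  by field; rewrite !gt_eqF.
have G0 := poly_gauss_mass_ge0 n b.
apply: (le_trans (ler_normB _ _)); rewrite [leRHS]mulrDl lerD//.
  rewrite normrM normfV (gtr0_norm Z0) mulrAC; apply: ler_pM => //.
  - by rewrite invr_ge0 ltW.
  - by rewrite mulrC mulrA.
  - by rewrite lef_pV2// posrE.
rewrite normrM normfV normrM (gtr0_norm (mulr_gt0 Z0 Z0')) [leRHS]mulrAC.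
apply: ler_pM => //.
- by rewrite invr_ge0 ltW// mulr_gt0.
- by rewrite -(mulrA (B * poly_gauss_mass n b)); apply: ler_pM => //; rewrite mulrC mulrA.
- by rewrite lef_pV2 ?posrE ?exprn_gt0 ?mulr_gt0// expr2; apply: ler_pM => //; exact: ltW.
Qed.

End stability.

(** * Conditional laws *)

Section conditioning.
Context {R : realType}.

(** The density of [(u, y)] as a function of [u], up to a constant factor: it
    determines the conditional law given [y]. *)
Definition slice d K (P : 'M[R]_(d + K)) (m : 'rV[R]_(d + K)) (y : 'rV[R]_K)
  (u : 'rV[R]_d) : R := gauss P m (row_mx u y).

Lemma measurable_slice d K (P : 'M[R]_(d + K)) m y : measurable_fun setT (slice P m y).
Proof.
apply: measurableT_comp; first exact: measurable_gauss.
exact: measurable_row_mx.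
Qed.

(** The decay is kept in [u] only; the fixed [y] can only improve the bound. *)
Lemma slice_le d K (P : 'M[R]_(d + K)) a m y u : 0 <= a ->
  (forall v, a * sqn v <= qf P v) ->
  slice P m y u <= expR (a / 2 * sqn m) * expR (- (a / 4) * sqn u).
Proof.
move=> a0 aP; apply: (le_trans (gauss_le _ _ a0 aP)).
rewrite ler_wpM2l ?expR_ge0// ler_expR sqn_row !mulNr lerN2.
by rewrite ler_wpM2l ?divr_ge0// lerDl sqn_ge0.
Qed.

Lemma integrable_slice d K (P : 'M[R]_(d + K)) a m y g : 0 < a ->
  (forall v, a * sqn v <= qf P v) -> measurable_fun setT g -> growth 2 g ->
  (lebesgue_rV d).-integrable setT (fun u => (g u * slice P m y u)%:E).
Proof.
move=> a0 aP mg [M M0 hM].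
apply: (@integrable_poly_gauss _ _ (a / 4) (M * expR (a / 2 * sqn m))) => //.
- by rewrite divr_gt0.
- by rewrite mulr_ge0// expR_ge0.
- by apply: measurable_funM => //; exact: measurable_slice.
- move=> x; rewrite normrM (ger0_norm (gauss_ge0 _ _ _)).
  by rewrite mulrACA; apply: ler_pM; rewrite ?gauss_ge0//; exact: slice_le (ltW a0) aP.
Qed.

Lemma integrable_slice1 d K (P : 'M[R]_(d + K)) a m y : 0 < a ->
  (forall v, a * sqn v <= qf P v) ->
  (lebesgue_rV d).-integrable setT (EFin \o slice P m y).
Proof.
move=> a0 aP.
have mc : measurable_fun setT (fun _ : 'rV[R]_d => 1 : R) by exact: measurable_cst.
have := integrable_slice m y a0 aP mc (growth_le (leq0n 2) (growth_cst _ _)).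
by apply: eq_integrable => // u _; rewrite mul1r.
Qed.

Lemma slice_ge d K (P : 'M[R]_(d + K)) (c s t : R) m y u : 0 <= c ->
  (forall v, qf P v <= c * sqn v) -> sqn m <= s -> sqn y <= t ->
  expR (- c * (s + t)) * expR (- c * sqn u) <= slice P m y u.
Proof.
move=> c0 Pc ms yt; rewrite -expRD ler_expR.
have := Pc (row_mx u y - m); have := sqnB (row_mx u y) m; rewrite sqn_row.
move: (sqn u) (sqn y) (sqn m) (sqn _) (qf P _) ms yt => a b e f q *; nra.
Qed.

(** The normalising constant of the Gaussian cancels in the quotient. *)
Lemma integral_condition d K (mu : probability 'rV[R]_(d + K) R) m C
    (y : 'rV[R]_K) f :
  pd C -> density mu (gaussian_pdf m C) -> measurable_fun setT f ->
  growth 2 f ->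
  let E := slice (invmx C) m y in
  (\int[condition y mu]_u (f u)%:E =
    ((\int[lebesgue_rV d]_u (f u * E u)) / (\int[lebesgue_rV d]_u E u))%:E)%E.
Proof.
move=> pC dmu mf gf E.
have [a a0 aP] := pd_inv_lower pC.
have iE := integrable_slice1 m y a0 aP.
have N0 := gaussian_normalizer_gt0 dmu; set N := Num.sqrt _ in N0.
set Z := \int[lebesgue_rV d]_u E u.
have Z0 : 0 <= Z by apply: Rintegral_ge0 => u _; exact: gauss_ge0.
have cE : condition y mu = fun A => (\int[lebesgue_rV d]_(u in A) (Z^-1 * E u)%:E)%E.
  apply/funext => A; apply: eq_integral => u _; congr EFin.
  rewrite (cdensity_gaussian dmu) gaussian_pdfE.
  have -> : \int[lebesgue_rV d]_U gaussian_pdf m C (row_mx U y) = N^-1 * Z.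
    rewrite -RintegralZl//; apply: eq_Rintegral => U _; exact: gaussian_pdfE.
  by rewrite invfM invrK mulrACA -/N mulVf ?gt_eqF// mul1r mulrC.
rewrite cE integral_induced_density//; last 2 first.
- by move=> u; rewrite mulr_ge0 ?invr_ge0// gauss_ge0.
- exact: integrableZl iE.
have iF := integrable_slice m y a0 aP mf gf.
under eq_integral do rewrite mulrCA EFinM.
rewrite integralZl// -/E mulrC EFinM; congr (_ * _)%E.
by rewrite fineK// integrable_fin_num.
Qed.

Lemma le_dist_g n (mu1 mu2 : set 'rV[R]_n -> \bar R) (f : 'rV[R]_n -> R) :
  measurable_fun setT f -> (forall x, `|f x| <= 1 + enorm x ^+ 2) ->
  (`|\int[mu1]_x (f x)%:E - \int[mu2]_x (f x)%:E| <= dist_g mu1 mu2)%E.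
Proof. by move=> mf hf; apply: ereal_sup_ubound; exists f. Qed.

Lemma dist_g_ge0 n (mu1 mu2 : set 'rV[R]_n -> \bar R) : (0 <= dist_g mu1 mu2)%E.
Proof.
apply: le_trans (@le_dist_g n mu1 mu2 (fun=> 0) _ _) => // x.
by rewrite normr0 addr_ge0 ?sqr_ge0.
Qed.

(** The functions [x_i] and [x_i x_j] are admissible test functions, and
    [C_ij = E (x_i x_j) - m_i m_j]; the means are bounded by [r], whence
    [1 + 2 r]. *)
Lemma gaussian_params_le_dist_g n (pi p : probability 'rV[R]_n R)
    m C m' C' (r D : R) :
  pd C -> density pi (gaussian_pdf m C) ->
  pd C' -> density p (gaussian_pdf m' C') ->
  1 <= r -> sqn m <= r ^+ 2 -> sqn m' <= r ^+ 2 ->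
  (dist_g pi p <= D%:E)%E ->
  (forall i, `|m 0 i - m' 0 i| <= D) /\
  (forall i j, `|C i j - C' i j| <= (1 + 2 * r) * D).
Proof.
move=> pC dpi pC' dp r1 mr mr' hD.
have mD i : `|m 0 i - m' 0 i| <= D.
  have := le_trans (@le_dist_g n pi p (fun x => x 0 i) _ _) hD.
  rewrite (integral_gaussian_coord pC dpi) (integral_gaussian_coord pC' dp).
  rewrite -EFinB lee_fin; apply; first exact: (measurable_coord (T := R)).
  move=> x; rewrite enorm_sqr; have := coord_le_sqn x i.
  by rewrite -(real_normK (num_real (x 0 i))); have := normr_ge0 (x 0 i); nra.
split => // i j.
have := le_trans (@le_dist_g n pi p (fun x => x 0 i * x 0 j) _ _) hD.
rewrite (integral_gaussian_coordM pC dpi) (integral_gaussian_coordM pC' dp).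
rewrite -EFinB lee_fin => h.
have {}h : `|C i j + m 0 i * m 0 j - (C' i j + m' 0 i * m' 0 j)| <= D.
  apply: h; first by apply: measurable_funM; exact: (measurable_coord (T := R)).
  move=> x; rewrite enorm_sqr normrM.
  have := coord_le_sqn x i; have := coord_le_sqn x j.
  rewrite -(real_normK (num_real (x 0 i))) -(real_normK (num_real (x 0 j))).
  by have := normr_ge0 (x 0 i); have := normr_ge0 (x 0 j); nra.
have coordr (v : 'rV[R]_n) k : sqn v <= r ^+ 2 -> `|v 0 k| <= r.
  move=> vr; rewrite -(ler_pXn2r (n := 2))// ?nnegrE ?(le_trans ler01)//.
  by rewrite real_normK ?num_real// (le_trans (coord_le_sqn _ _)).
have -> : C i j - C' i j = (C i j + m 0 i * m 0 j - (C' i j + m' 0 i * m' 0 j))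
   - (m 0 i * (m 0 j - m' 0 j) + (m 0 i - m' 0 i) * m' 0 j) by ring.
apply: (le_trans (ler_normB _ _)); rewrite [leRHS]mulrDl mul1r lerD//.
apply: (le_trans (ler_normD _ _)); rewrite !normrM -mulrA mulr_natl mulr2n lerD//.
  by apply: ler_pM => //; exact: coordr.
by rewrite mulrC; apply: ler_pM => //; exact: coordr.
Qed.

(** The constant is absolute because [(r ^- 2 / 2) * |m|^2 <= 1 / 2]. *)
Lemma slice_le_uniform d K (r : R) (C : 'M[R]_(d + K)) m (y : 'rV[R]_K) u :
  0 < r -> pd C -> (forall v, qf C v <= r ^+ 2 * sqn v) -> sqn m <= r ^+ 2 ->
  slice (invmx C) m y u <= expR 2^-1 * expR (- ((r ^+ 2)^-1 / 4) * sqn u).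
Proof.
move=> r0 pC uC mr; have r20 : 0 < r ^+ 2 by rewrite exprn_gt0.
have a0 : 0 <= (r ^+ 2)^-1 by rewrite invr_ge0 ltW.
apply: (le_trans (slice_le _ _ _ a0 _)).
  by move=> v; exact: invmx_lower.
rewrite ler_wpM2r ?expR_ge0// ler_expR mulrAC ler_piMl//.
by rewrite ler_pdivrMl// mulr1.
Qed.

Lemma slice_mass_ge d K (r kappa w : R) (C : 'M[R]_(d + K)) m (y : 'rV[R]_K) :
  0 < r -> pd C ->
  (forall v, (r ^+ 2)^-1 * sqn v <= qf C v) ->
  (forall v, qf C v <= r ^+ 2 * sqn v) ->
  sqn m <= r ^+ 2 -> sqn y <= kappa ^+ 2 ->
  (\int[lebesgue_rV d]_u (expR (- r ^+ 2 * sqn u))%:E = w%:E)%E ->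
  expR (- r ^+ 2 * (r ^+ 2 + kappa ^+ 2)) * w <=
    \int[lebesgue_rV d]_u slice (invmx C) m y u.
Proof.
move=> r0 pC lC uC mr yk hw; have r20 : 0 < r ^+ 2 by rewrite exprn_gt0.
have a0 : 0 < (r ^+ 2)^-1 by rewrite invr_gt0.
have aP v : (r ^+ 2)^-1 * sqn v <= qf (invmx C) v by exact: invmx_lower.
have rP v : qf (invmx C) v <= r ^+ 2 * sqn v.
  by have := invmx_upper v pC a0 lC; rewrite invrK.
have iE := integrable_slice1 m y a0 aP.
have ig := integrable_gauss_rV d r20.
have -> : expR (- r ^+ 2 * (r ^+ 2 + kappa ^+ 2)) * w = \int[lebesgue_rV d]_u
    (expR (- r ^+ 2 * (r ^+ 2 + kappa ^+ 2)) * expR (- r ^+ 2 * sqn u)).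
  by rewrite RintegralZl// /Rintegral hw.
apply: le_Rintegral => //; first exact: integrableZl ig.
by move=> u _; apply: slice_ge => //; exact: ltW.
Qed.

(** Pointwise closeness of the unnormalised densities: the exponents are close by
    [qf_invmx_lipschitz], and [exp] is Lipschitz with a constant that decays. *)
Lemma slice_lipschitz d K (r kappa D : R) (C C' : 'M[R]_(d + K)) m m'
    (y : 'rV[R]_K) u :
  1 <= r -> 0 <= D -> pd C -> pd C' ->
  (forall v, (r ^+ 2)^-1 * sqn v <= qf C v) ->
  (forall v, (r ^+ 2)^-1 * sqn v <= qf C' v) ->
  (forall v, qf C v <= r ^+ 2 * sqn v) ->
  (forall v, qf C' v <= r ^+ 2 * sqn v) ->
  sqn m <= r ^+ 2 -> sqn m' <= r ^+ 2 -> sqn y <= kappa ^+ 2 ->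
  (forall i, `|m 0 i - m' 0 i| <= D) ->
  (forall i j, `|C i j - C' i j| <= (1 + 2 * r) * D) ->
  `|slice (invmx C) m y u - slice (invmx C') m' y u| <=
    D * (qf_lip (d + K) r * expR 2^-1 * (1 + kappa ^+ 2)) *
    ((1 + sqn u) * expR (- ((r ^+ 2)^-1 / 4) * sqn u)).
Proof.
move=> r1 D0 pC pC' lC lC' uC uC' mr mr' yk mD CD.
have r0 : 0 < r by rewrite (lt_le_trans ltr01).
have b1 := slice_le_uniform y u r0 pC uC mr.
have b2 := slice_le_uniform y u r0 pC' uC' mr'.
have qd := qf_invmx_lipschitz (row_mx u y) r1 D0 pC pC' lC lC' mr mr' mD CD.
rewrite /slice /gauss in b1 b2 *; apply: (le_trans (expR_diff_le _ _)).
set X := 1 + sqn (row_mx u y) in qd.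
have X0 : 0 <= X by rewrite addr_ge0// sqn_ge0.
have XX : X <= (1 + kappa ^+ 2) * (1 + sqn u).
  rewrite /X sqn_row; have := sqn_ge0 u; have := sqn_ge0 y; move: yk.
  by move: (sqn u) (sqn y) (kappa ^+ 2) => *; nra.
set q := qf _ _ in qd b1 *; set q' := qf _ _ in qd b2 *.
have -> : - q / 2 - - q' / 2 = - ((q - q') / 2) by field.
rewrite normrN normrM (@ger0_norm _ 2^-1)//.
set e := expR (- ((r ^+ 2)^-1 / 4) * sqn u) in b1 b2 *.
have e0 : 0 <= e by exact: expR_ge0.
set B := expR 2^-1 in b1 b2 *; have B0 : 0 <= B by exact: expR_ge0.
have c0 := qf_lip_ge0 (d + K) (ltW r0); set c := qf_lip _ _ in qd c0 *.
apply: (@le_trans _ _ (D * (c * X) / 2 * (2 * (B * e)))).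
  apply: ler_pM; rewrite ?addr_ge0 ?expR_ge0 ?mulr_ge0//.
    by rewrite ler_wpM2r.
  by rewrite mulr_natl mulr2n lerD.
have -> : D * (c * X) / 2 * (2 * (B * e)) = D * (c * B) * e * X by field.
have -> : D * (c * B * (1 + kappa ^+ 2)) * ((1 + sqn u) * e) =
    D * (c * B) * e * ((1 + kappa ^+ 2) * (1 + sqn u)) by ring.
by rewrite ler_wpM2l// !mulr_ge0.
Qed.

End conditioning.

(** * Lipschitz continuity of conditioning *)

Theorem lemma31 (R : realType) (d K : nat) (hd : (1 <= d)%N) (hK : (1 <= K)%N)
    (kappa : R) (hkappa : 0 < kappa) (r : R) (hr : 1 <= r) :
  exists L : R, forall (J : nat) (hJ : (1 <= J)%N) (y : 'I_J -> 'rV[R]_K),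
    (forall j, enorm (y j) <= kappa) ->
    forall pi p : probability 'rV[R]_(d + K) R,
      gaussian_within r pi -> gaussian_within r p ->
      forall j : 'I_J,
        (dist_g (condition (y j) pi) (condition (y j) p)
          <= L%:E * dist_g pi p)%E.
Proof.
have r0 : 0 < r by rewrite (lt_le_trans ltr01).
have r20 : 0 < r ^+ 2 by rewrite exprn_gt0.
pose a := (r ^+ 2)^-1.
have a0 : 0 < a by rewrite invr_gt0.
pose B : R := expR 2^-1.
have B0 : 0 <= B by exact: expR_ge0.
pose c := qf_lip (d + K) r * B * (1 + kappa ^+ 2).
have c0 : 0 <= c.
  apply: mulr_ge0; last by rewrite addr_ge0// sqr_ge0.
  by apply: mulr_ge0 => //; exact: qf_lip_ge0 (ltW r0).
have [w w0 hw] := integral_gauss_rV_gt0 d r20.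
(* a lower bound for the normalising integrals of the conditional densities *)
pose z := expR (- r ^+ 2 * (r ^+ 2 + kappa ^+ 2)) * w.
have z0 : 0 < z by rewrite mulr_gt0// expR_gt0.
pose G := poly_gauss_mass (R := R) d (a / 4).
pose L := c * G / z + B * G * (c * G) / z ^+ 2.
have L0 : 0 <= L.
  have G0 : 0 <= G by exact: poly_gauss_mass_ge0.
  have cG : 0 <= c * G by exact: mulr_ge0.
  apply: addr_ge0; first by rewrite divr_ge0// ltW.
  by rewrite divr_ge0 ?sqr_ge0//; apply: mulr_ge0 => //; exact: mulr_ge0.
(* the summand 1 makes the constant positive, which is what makes the right-hand
   side infinite when [dist_g pi p] is *)
exists (L + 1) => J _ y hy pi p [[m [C [pC dpi]]] + + +] [[m' [C' [pC' dp]]] + + +] j.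
rewrite (mean_gaussian pC dpi) (cov_gaussian pC dpi).
rewrite (mean_gaussian pC' dp) (cov_gaussian pC' dp).
move=> /enorm_le mr /loewner_lowerP lC /loewner_upperP uC.
move=> /enorm_le mr' /loewner_lowerP lC' /loewner_upperP uC'.
have yk := enorm_le (hy j).
have D0 := dist_g_ge0 pi p.
case hD : (dist_g pi p) D0 => [D| |] //; last first.
  by rewrite gt0_muley ?leey// lte_fin; lra.
rewrite lee_fin => D0.
apply: ge_ereal_sup => _ [f [mf hf] <-].
have gf : growth 2 f.
  apply: (@growth_le _ _ 1%N) => //; exists 1 => // x.
  by rewrite mul1r expr1 -enorm_sqr.
rewrite (integral_condition _ pC dpi mf gf) (integral_condition _ pC' dp mf gf).
rewrite -EFinB lee_fin.
have [mD CD] : (forall i, `|m 0 i - m' 0 i| <= D) /\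
    (forall i j, `|C i j - C' i j| <= (1 + 2 * r) * D).
  by apply: (gaussian_params_le_dist_g pC dpi pC' dp) => //; rewrite hD.
apply: (@le_trans _ _ (L * D)); last by rewrite ler_wpM2r// lerDl.
apply: (@ratio_lipschitz _ _ (a / 4) B c D z) => //.
- by rewrite divr_gt0.
- exact: measurable_slice.
- exact: measurable_slice.
- by move=> u; rewrite ger0_norm ?gauss_ge0//; exact: slice_le_uniform.
- by move=> u; rewrite ger0_norm ?gauss_ge0//; exact: slice_le_uniform.
- by move=> u; exact: slice_lipschitz.
- by move=> u; rewrite -enorm_sqr.
- exact: slice_mass_ge.
- exact: slice_mass_ge.
Qed.
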